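(* Consider a model of horizon $T$ whose potentials satisfy $G_t(x_{t-1},x_t)=G_t(x_t)$ for $t\ge2$, and suppose the strong mixing assumption holds with constant $\boldsymbol{\epsilon}$ (see context). Let $c_*=\boldsymbol{\epsilon}^{-1}$. Then for all $N\ge2$ and all $s_{\mathrm{ref}},\tilde s_{\mathrm{ref}}\in\mathsf{X}^T$, the output $(S,\tilde S)\leftarrow\mathrm{CCPF}(s_{\mathrm{ref}},\tilde s_{\mathrm{ref}},N)$ satisfies $$\mathbb{P}(S=\tilde S)\ge1-\frac{2^T\,T}{(2c_* )^{-1}(N-1)+1}.$$
   Context: Model. $\mathsf{X}$ is a measurable space with a $\sigma$-finite measure written $\mathrm{d}x$. A model of horizon $T$ (with potentials depending only on the current state) consists of a probability density $M_1$ on $\mathsf{X}$, Markov transition densities $M_t(x_{t-1},x_t)$ (densities in $x_t$), $t=2,\dots,T$, and measurable potentials $G_t:\mathsf{X}\to[0,\infty)$, $t=1,\dots,T$, with $c_T=\int M_1(x_1)G_1(x_1)\prod_{t=2}^T M_t(x_{t-1},x_t)G_t(x_t)\,\mathrm{d}x_{1:T}\in(0,\infty)$. Strong mixing assumption. $G_*(t)=\inf_x G_t(x)>0$ and $G^*(t)=\sup_x G_t(x)<\infty$ for $t=1,\dots,T$; $M_*(t)=\inf_{x,y}M_t(x,y)>0$ and $M^*(t)=\sup_{x,y}M_t(x,y)<\infty$ for $t=2,\dots,T$. Set $$\boldsymbol{\epsilon}=\min_{t=1,\dots,T-1}\frac{G_*(t)M_*(t+1)G_*(t+1)}{G^*(t)M^*(t+1)G^*(t+1)},$$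 with $\boldsymbol{\epsilon}=G_*(1)/G^*(1)$ when $T=1$. Coupled resampling $\mathrm{CRes}(\omega^{(1:N)},\tilde\omega^{(1:N)},n)$: let $w^{(i)}=\omega^{(i)}/\sum_j\omega^{(j)}$, $\tilde w^{(i)}=\tilde\omega^{(i)}/\sum_j\tilde\omega^{(j)}$, $p_c=\sum_j w^{(j)}\wedge\tilde w^{(j)}$, $w_c=(w\wedge\tilde w)/p_c$, $w_r=(w-w\wedge\tilde w)/(1-p_c)$, $\tilde w_r=(\tilde w-w\wedge\tilde w)/(1-p_c)$. Independently for $i=1,\dots,n$: with probability $p_c$ draw $I^{(i)}=\tilde I^{(i)}\sim w_c$; otherwise draw independently $I^{(i)}\sim w_r$, $\tilde I^{(i)}\sim\tilde w_r$. Output $(I^{(1:n)},\tilde I^{(1:n)})$. $\mathrm{CCPF}(X^*_{1:T},\tilde X^*_{1:T},N)$ (coupled conditional particle filter): 1. $(X_{1:T}^{(1)},\tilde X_{1:T}^{(1)})=(X^*_{1:T},\tilde X^*_{1:T})$; for $i=2,\dots,N$ independently $X_1^{(i)}=\tilde X_1^{(i)}\sim M_1$; $\omega_1^{(i)}=G_1(X_1^{(i)})$, $\tilde\omega_1^{(i)}=G_1(\tilde X_1^{(i)})$ for $i=1,\dots,N$. 2. For $t=2,\dots,T$: $I_t^{(1)}=\tilde I_t^{(1)}=1$; $(I_t^{(2:N)},\tilde I_t^{(2:N)})\leftarrow\mathrm{CRes}(\omega_{t-1}^{(1:N)},\tilde\omega_{t-1}^{(1:N)},N-1)$; conditionally independently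 over $i=2,\dots,N$: if $X_{t-1}^{(I_t^{(i)})}=\tilde X_{t-1}^{(\tilde I_t^{(i)})}$ draw $X_t^{(i)}=\tilde X_t^{(i)}\sim M_t(X_{t-1}^{(I_t^{(i)})},\cdot)$, otherwise draw $(X_t^{(i)},\tilde X_t^{(i)})$ from any (fixed, measurable) coupling of $M_t(X_{t-1}^{(I_t^{(i)})},\cdot)$ and $M_t(\tilde X_{t-1}^{(\tilde I_t^{(i)})},\cdot)$; set $\omega_t^{(i)}=G_t(X_t^{(i)})$, $\tilde\omega_t^{(i)}=G_t(\tilde X_t^{(i)})$ for $i=1,\dots,N$. 3. $(J_T,\tilde J_T)\leftarrow\mathrm{CRes}(\omega_T^{(1:N)},\tilde\omega_T^{(1:N)},1)$; for $t=T-1,\dots,1$: $(J_t,\tilde J_t)=(I_{t+1}^{(J_{t+1})},\tilde I_{t+1}^{(\tilde J_{t+1})})$. 4. Output $(X_{1:T}^{(J_{1:T})},\tilde X_{1:T}^{(\tilde J_{1:T})})$, where $X_{1:T}^{(J_{1:T})}=(X_1^{(J_1)},\dots,X_T^{(J_T)})$. *)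

(* Defs.v *)
From HB Require Import structures.
From mathcomp Require Import all_boot all_order all_algebra.
From mathcomp Require Import all_classical all_reals all_analysis.
From mathcomp Require Import measurable_realfun giry.

Set Implicit Arguments.
Unset Strict Implicit.
Unset Printing Implicit Defensive.
Import Order.TTheory GRing.Theory Num.Theory.
Import numFieldNormedType.Exports.

Local Open Scope classical_set_scope.
Local Open Scope ring_scope.

HB.instance Definition _ n := isPointed.Build 'I_n.+1 ord0.
HB.instance Definition _ n := @isMeasurable.Build default_measure_display
  'I_n.+1 discrete_measurable discrete_measurable0
  discrete_measurableC discrete_measurableU.

Section sequencing.
Context d1 d2 (Y : measurableType d1) (Z : measurableType d2) (R : realType).
Variable k : Y -> giry Z R.
Hypothesis mk : measurable_fun [set: Y] k.

(** Law of [(y, z)] with [z ~ k y]: binding with [keep k] draws [z] while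
    remembering the randomness already drawn. *)
Definition keep (y : Y) : giry (Y * Z)%type R :=
  giry_prod (giry_ret y : giry Y R, k y).

Lemma measurable_keep : measurable_fun [set: Y] keep.
Proof.
apply: (@measurableT_comp _ _ _ _ _ _ (@giry_prod _ _ Y Z R)
  _ (fun y => (giry_ret y : giry Y R, k y))).
  exact: measurable_giry_prod.
by apply: measurable_fun_pair => //; exact: measurable_giry_ret.
Qed.

End sequencing.

Section independent_draws.
Context d (Y : measurableType d) (R : realType).

(** Law of [n] independent draws, the [i]-th one from [tnth m i]. *)
Fixpoint gtprod n : n.-tuple (giry Y R) -> giry (n.-tuple Y) R :=
  match n with
  | 0 => fun=> giry_ret [tuple]
  | n'.+1 => fun m => giry_map
      (measurable_cons (@measurable_fst _ _ Y (n'.-tuple Y)) measurable_snd)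
      (giry_prod (thead m, gtprod [tuple of behead m]))
  end.

Lemma measurable_gtprod n :
  measurable_fun [set: n.-tuple (giry Y R)] (@gtprod n).
Proof.
elim: n => [|n IH] /=; first exact: measurable_cst.
apply: (@measurableT_comp _ _ _ _ _ _ (giry_map _)).
  exact: measurable_giry_map.
apply: (@measurableT_comp _ _ _ _ _ _ (@giry_prod _ _ Y (n.-tuple Y) R)
  _ (fun m => (thead m, gtprod [tuple of behead m]))).
  exact: measurable_giry_prod.
apply: measurable_fun_pair; first exact: measurable_tnth.
by apply: measurableT_comp => //; exact: measurable_behead.
Qed.

End independent_draws.

Section finite_law.
Context d (I : measurableType d) (R : realType) (J : finType) (f : J -> I).
Variable q : J -> R.
Hypothesis q_ge0 : forall i, 0 <= q i.
Hypothesis q_le1 : \sum_i q i <= 1.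

Definition flaw_set (A : set I) : \bar R :=
  (\sum_(i : J) (q i)%:E * \d_(f i) A)%E.

Let flaw_set0 : flaw_set set0 = 0%E.
Proof. by rewrite /flaw_set big1// => i _; rewrite measure0 mule0. Qed.

Let flaw_ge0 A : (0 <= flaw_set A)%E.
Proof. by apply: sume_ge0 => i _; rewrite mule_ge0// lee_fin. Qed.

Let flaw_sigma_additive : semi_sigma_additive flaw_set.
Proof.
move=> F mF tF mUF; rewrite [X in X @ _ --> _](_ : _ = fun n =>
  (\sum_(i : J) (q i)%:E * \sum_(0 <= k < n) \d_(f i) (F k))%E).
  apply: cvg_nnesum => [i _|i _].
    by near=> n; rewrite mule_ge0 ?lee_fin// sume_ge0.
  by apply: cvgeZl => //; exact: measure_semi_sigma_additive.
apply/funext => n; rewrite /flaw_set exchange_big/=.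
by apply: eq_bigr => i _; rewrite ge0_sume_distrr.
Unshelve. all: by end_near. Qed.

HB.instance Definition _ := isMeasure.Build _ _ _ flaw_set
  flaw_set0 flaw_ge0 flaw_sigma_additive.

Let flaw_setT : (flaw_set [set: I] <= 1)%E.
Proof.
rewrite /flaw_set; under eq_bigr do rewrite diracT mule1.
by rewrite sumEFin lee_fin.
Qed.

HB.instance Definition _ :=
  Measure_isSubProbability.Build _ _ _ flaw_set flaw_setT.

Definition flaw : giry I R := flaw_set.

End finite_law.

Section finite_law_measurable.
Context d d' (Y : measurableType d') (I : measurableType d) (R : realType).
Context (J : finType) (f : J -> I) (q : Y -> J -> R).
Hypothesis q_ge0 : forall y i, 0 <= q y i.
Hypothesis q_le1 : forall y, \sum_i q y i <= 1.
Hypothesis mq : forall i, measurable_fun [set: Y] (q ^~ i).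

Lemma measurable_flaw :
  measurable_fun [set: Y] (fun y => flaw f (q_ge0 y) (q_le1 y)).
Proof.
apply: measurable_giry_codensity => // B mB.
apply: emeasurable_sum => i.
by apply: emeasurable_funM => //; exact/measurable_EFinP.
Qed.

End finite_law_measurable.

Section density_law.
Context d (X : measurableType d) (R : realType).
Variables (mu : {measure set X -> \bar R}) (f : X -> R).
Hypothesis f_ge0 : forall x, 0 <= f x.
Hypothesis mf : measurable_fun [set: X] f.
Hypothesis f_int1 : (\int[mu]_x (f x)%:E = 1)%E.

Definition dens_set (A : set X) : \bar R := (\int[mu]_(x in A) (f x)%:E)%E.

Let dens_set0 : dens_set set0 = 0%E.
Proof. by rewrite /dens_set integral_set0. Qed.

Let dens_ge0 A : (0 <= dens_set A)%E.
Proof. by apply: integral_ge0 => x _; rewrite lee_fin. Qed.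

Let dens_sigma_additive : semi_sigma_additive dens_set.
Proof.
move=> F mF tF mUF; rewrite /dens_set ge0_integral_bigcup//; last first.
- by move=> x _; rewrite lee_fin.
- by apply/measurable_EFinP; exact: measurable_funTS.
by apply: is_cvg_ereal_nneg_natsum_cond => n _ _; exact: dens_ge0.
Qed.

HB.instance Definition _ := isMeasure.Build _ _ _ dens_set
  dens_set0 dens_ge0 dens_sigma_additive.

Let dens_setT : (dens_set [set: X] <= 1)%E.
Proof. by rewrite /dens_set f_int1. Qed.

HB.instance Definition _ :=
  Measure_isSubProbability.Build _ _ _ dens_set dens_setT.

Definition dens : giry X R := dens_set.

End density_law.

Lemma measurable_fun_inv_ge0 d (Y : measurableType d) (R : realType)
    (f : Y -> R) : (forall y, 0 <= f y) -> measurable_fun [set: Y] f ->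
  measurable_fun [set: Y] (fun y => (f y)^-1).
Proof.
move=> f0 mf; rewrite (_ : (fun _ => _) = (@powR R ^~ (-1)) \o f).
  by apply: measurableT_comp => //; exact: measurable_powR.
by apply/funext => y /=; rewrite powR_inv1.
Qed.

Lemma measurable_fun_tnth d1 d2 (Y : measurableType d1) (Z : measurableType d2)
    n (f : Y -> n.+1.-tuple Z) (g : Y -> 'I_n.+1) :
  measurable_fun [set: Y] f -> measurable_fun [set: Y] g ->
  measurable_fun [set: Y] (fun y => tnth (f y) (g y)).
Proof.
move=> mf mg _ B mB; rewrite setTI.
rewrite (_ : _ @^-1` B = \big[setU/set0]_(i < n.+1)
  ((fun y => tnth (f y) i) @^-1` B `&` g @^-1` [set i])).
  apply: bigsetU_measurable => i _; apply: measurableI.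
    rewrite -[X in measurable X]setTI.
    by apply: (measurableT_comp (measurable_tnth i) mf).
  by rewrite -[X in measurable X]setTI; exact: mg.
rewrite -bigcup_seq; apply/seteqP; split=> [y By|y [i _ [Bi /= gi]]].
  by exists (g y) => //=; rewrite mem_index_enum.
by rewrite /= gi.
Qed.

Section cres.
Context (R : realType) (n : nat).
Implicit Types w v : 'I_n.+1 -> R.

Definition nweight w i : R := w i / \sum_j w j.

Definition cres_min w v i : R := Num.min (nweight w i) (nweight v i).

Definition cres_pc w v : R := \sum_j cres_min w v j.

Definition cres_common w v i : R := cres_min w v i / cres_pc w v.

Definition cres_resid w v i : R :=
  (nweight w i - cres_min w v i) / (1 - cres_pc w v).

(** Mass of [(I, I~) = (a, b)] for one draw. The conventions [0 / 0 = 0] in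
    [cres_common] and [cres_resid] are harmless, since these factors are then
    multiplied by [0]. *)
Definition cres_mass w v (ab : 'I_n.+1 * 'I_n.+1) : R :=
  cres_pc w v * (cres_common w v ab.1 *+ (ab.1 == ab.2)) +
  (1 - cres_pc w v) * (cres_resid w v ab.1 * cres_resid v w ab.2).

Lemma cres_minC w v i : cres_min w v i = cres_min v w i.
Proof. by rewrite /cres_min minC. Qed.

Lemma cres_pcC w v : cres_pc w v = cres_pc v w.
Proof. by apply: eq_bigr => i _; rewrite cres_minC. Qed.

Section nonnegative_weights.
Variables w v : 'I_n.+1 -> R.
Hypotheses (w0 : forall i, 0 <= w i) (v0 : forall i, 0 <= v i).

Lemma nweight_ge0 i : 0 <= nweight w i.
Proof. by rewrite divr_ge0// sumr_ge0. Qed.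

Lemma nweight_sum_le1 : \sum_i nweight w i <= 1.
Proof.
rewrite /nweight -mulr_suml; have [->|?] := eqVneq (\sum_j w j) 0.
  by rewrite mul0r ler01.
by rewrite divff.
Qed.

Lemma cres_min_le i : cres_min w v i <= nweight w i.
Proof. by rewrite /cres_min ge_min lexx. Qed.

End nonnegative_weights.

Lemma cres_min_ge0 w v : (forall i, 0 <= w i) -> (forall i, 0 <= v i) ->
  forall i, 0 <= cres_min w v i.
Proof. by move=> w0 v0 i; rewrite /cres_min le_min !nweight_ge0. Qed.

Lemma cres_pc_ge0 w v : (forall i, 0 <= w i) -> (forall i, 0 <= v i) ->
  0 <= cres_pc w v.
Proof. by move=> w0 v0; apply: sumr_ge0 => i _; exact: cres_min_ge0. Qed.

Lemma cres_pc_le1 w v : (forall i, 0 <= w i) -> cres_pc w v <= 1.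
Proof.
move=> w0; apply: le_trans (nweight_sum_le1 w).
by apply: ler_sum => i _; exact: cres_min_le.
Qed.

Lemma cres_resid_ge0 w v : (forall i, 0 <= w i) ->
  forall i, 0 <= cres_resid w v i.
Proof.
by move=> w0 i; rewrite divr_ge0// subr_ge0 ?cres_min_le ?cres_pc_le1.
Qed.

Lemma cres_resid_sum_le1 w v : (forall i, 0 <= w i) ->
  \sum_i cres_resid w v i <= 1.
Proof.
move=> w0; rewrite -mulr_suml sumrB -/(cres_pc w v).
have [->|pc1] := eqVneq (1 - cres_pc w v) 0; first by rewrite invr0 mulr0.
rewrite ler_pdivrMr ?mul1r ?lerD2r ?nweight_sum_le1//.
by rewrite lt_neqAle eq_sym pc1 subr_ge0 cres_pc_le1.
Qed.

Lemma cres_mass_ge0 w v : (forall i, 0 <= w i) -> (forall i, 0 <= v i) ->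
  forall ab, 0 <= cres_mass w v ab.
Proof.
move=> w0 v0 ab; apply: addr_ge0.
  rewrite mulr_ge0 ?cres_pc_ge0// mulrn_wge0// divr_ge0 ?cres_pc_ge0//.
  exact: cres_min_ge0.
rewrite mulr_ge0 ?subr_ge0 ?cres_pc_le1//.
by rewrite mulr_ge0// cres_resid_ge0.
Qed.

Lemma cres_mass_sum w v : \sum_ab cres_mass w v ab =
  cres_pc w v + (1 - cres_pc w v) *
    ((\sum_i cres_resid w v i) * \sum_i cres_resid v w i).
Proof.
rewrite big_split/= -!mulr_sumr; congr (_ + _ * _).
  transitivity (cres_pc w v * \sum_i cres_common w v i).
    congr (_ * _); rewrite -(pair_bigA _
      (fun a b => cres_common w v a *+ (a == b)))/=; apply: eq_bigr => a _.
    rewrite (bigD1 a)//= eqxx mulr1n big1 ?addr0// => b ba.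
    by rewrite eq_sym (negbTE ba).
  rewrite -mulr_suml -/(cres_pc w v).
  by have [->|?] := eqVneq (cres_pc w v) 0; rewrite ?mul0r// divff ?mulr1.
rewrite -(pair_bigA _ (fun a b => cres_resid w v a * cres_resid v w b))/=.
by rewrite mulr_suml; apply: eq_bigr => a _; rewrite mulr_sumr.
Qed.

Lemma cres_mass_le1 w v : (forall i, 0 <= w i) -> (forall i, 0 <= v i) ->
  \sum_ab cres_mass w v ab <= 1.
Proof.
move=> w0 v0; rewrite cres_mass_sum -lerBrDl ler_piMr//.
  by rewrite subr_ge0 cres_pc_le1.
rewrite mulr_ile1 ?cres_resid_sum_le1//; apply: sumr_ge0 => i _;
  exact: cres_resid_ge0.
Qed.

(** Law of one index pair; [CRes(w, v, n)] consists of [n] independent copies. *)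
Definition cres w v (w0 : forall i, 0 <= w i) (v0 : forall i, 0 <= v i) :
    giry ('I_n.+1 * 'I_n.+1)%type R :=
  flaw (fun ab : 'I_n.+1 * 'I_n.+1 => ab) (cres_mass_ge0 w0 v0) (cres_mass_le1 w0 v0).

End cres.

Section cres_measurable.
Context (R : realType) (n : nat) d (Y : measurableType d).
Variables w v : Y -> 'I_n.+1 -> R.
Hypothesis w0 : forall y i, 0 <= w y i.
Hypothesis v0 : forall y i, 0 <= v y i.
Hypothesis mw : forall i, measurable_fun [set: Y] (w ^~ i).
Hypothesis mv : forall i, measurable_fun [set: Y] (v ^~ i).

Let mnw (u : Y -> 'I_n.+1 -> R) (u0 : forall y i, 0 <= u y i)
    (mu : forall i, measurable_fun [set: Y] (u ^~ i)) i :
  measurable_fun [set: Y] (fun y => nweight (u y) i).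
Proof.
apply: measurable_funM => //; apply: measurable_fun_inv_ge0.
  by move=> y; exact: sumr_ge0.
exact: measurable_sum.
Qed.

Let mmin i : measurable_fun [set: Y] (fun y => cres_min (w y) (v y) i).
Proof. by apply: measurable_minr; exact: mnw. Qed.

Let mpc : measurable_fun [set: Y] (fun y => cres_pc (w y) (v y)).
Proof. exact: measurable_sum. Qed.

Let mqc : measurable_fun [set: Y] (fun y => 1 - cres_pc (w y) (v y)).
Proof. exact: measurable_funB. Qed.

Let mqcV : measurable_fun [set: Y] (fun y => (1 - cres_pc (w y) (v y))^-1).
Proof.
by apply: measurable_fun_inv_ge0 => // y; rewrite subr_ge0 cres_pc_le1.
Qed.

Lemma measurable_cres :
  measurable_fun [set: Y] (fun y => cres (w0 y) (v0 y)).
Proof.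
apply: measurable_flaw => -[a b]; apply: measurable_funD => /=.
  apply: measurable_funM => //; case: (a == b) => /=; last exact: measurable_cst.
  apply: measurable_funM => //; apply: measurable_fun_inv_ge0 => // y.
  exact: cres_pc_ge0.
apply: measurable_funM => //; apply: measurable_funM.
  apply: measurable_funM => //; apply: measurable_funB => //; exact: mnw.
apply: (eq_measurable_fun (fun y =>
  (nweight (v y) b - cres_min (w y) (v y) b) / (1 - cres_pc (w y) (v y)))).
  by move=> y _; rewrite /cres_resid cres_minC cres_pcC.
apply: measurable_funM => //; apply: measurable_funB => //; exact: mnw.
Qed.

End cres_measurable.

Record pdensity d (X : measurableType d) (R : realType)
    (mu : {measure set X -> \bar R}) := PDensity {
  pdensity_fun :> X -> R ;
  pdensity_ge0 : forall x, 0 <= pdensity_fun x ;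
  measurable_pdensity : measurable_fun [set: X] pdensity_fun ;
  pdensity_int1 : (\int[mu]_x (pdensity_fun x)%:E = 1)%E }.

Record tdensity d (X : measurableType d) (R : realType)
    (mu : {measure set X -> \bar R}) := TDensity {
  tdensity_fun :> X -> X -> R ;
  tdensity_ge0 : forall x y, 0 <= tdensity_fun x y ;
  measurable_tdensity :
    measurable_fun [set: X * X] (fun z => tdensity_fun z.1 z.2) ;
  tdensity_int1 : forall x, (\int[mu]_y (tdensity_fun x y)%:E = 1)%E }.

Record potential d (X : measurableType d) (R : realType) := Potential {
  potential_fun :> X -> R ;
  potential_ge0 : forall x, 0 <= potential_fun x ;
  measurable_potential : measurable_fun [set: X] potential_fun }.

(** Times are numbered from [1]. A model of horizon [T] only involves
    [M t] for [2 <= t <= T] and [G t] for [1 <= t <= T]; the other members of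
    the two families are never used. *)
Record model d (X : measurableType d) (R : realType)
    (mu : {measure set X -> \bar R}) := Model {
  M1 : pdensity mu ;
  M : nat -> tdensity mu ;
  G : nat -> potential X R }.

Section model_theory.
Context d (X : measurableType d) (R : realType).
Variable mu : {measure set X -> \bar R}.
Variable m : model mu.

(** [future k t x] is the integral of [prod_(t < s <= t + k) M s * G s] over
    [x_(t+1), ..., x_(t+k)], started from [x_t = x]. *)
Fixpoint future (k t : nat) (x : X) : \bar R :=
  if k is k'.+1 then
    (\int[mu]_y ((M m t.+1 x y * G m t.+1 y)%:E * future k' t.+1 y))%E
  else 1%E.

Definition normalizing_constant (T : nat) : \bar R :=
  (\int[mu]_x ((M1 m x * G m 1 x)%:E * future T.-1 1 x))%E.

Definition G_inf t : R := inf (range (G m t)).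
Definition G_sup t : R := sup (range (G m t)).
Definition M_inf t : R := inf (range (fun z : X * X => M m t z.1 z.2)).
Definition M_sup t : R := sup (range (fun z : X * X => M m t z.1 z.2)).

(** [sup] returns [0] on unbounded sets, so that finiteness of the suprema has
    to be stated as boundedness. *)
Definition strong_mixing (T : nat) : Prop :=
  (forall t, (1 <= t <= T)%N ->
    0 < G_inf t /\ has_ubound (range (G m t))) /\
  (forall t, (2 <= t <= T)%N ->
    0 < M_inf t /\ has_ubound (range (fun z : X * X => M m t z.1 z.2))).

Definition mixing_ratio t : R :=
  (G_inf t * M_inf t.+1 * G_inf t.+1) / (G_sup t * M_sup t.+1 * G_sup t.+1).

(** The neutral element [mixing_ratio 1] of the minimum is one of its terms. *)
Definition mixing_constant (T : nat) : R :=
  if (T <= 1)%N then G_inf 1 / G_sup 1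
  else \big[Num.min/mixing_ratio 1]_(1 <= t < T) mixing_ratio t.

Definition initial_law : giry X R :=
  dens (pdensity_ge0 (M1 m)) (measurable_pdensity (M1 m)) (pdensity_int1 (M1 m)).

End model_theory.

Section transition_law.
Context d (X : measurableType d) (R : realType).
Variable mu : {sigma_finite_measure set X -> \bar R}.
Variable K : tdensity mu.

Lemma measurable_tdensity_section x : measurable_fun [set: X] (K x).
Proof. exact: (measurable_fun_pair2 x (measurable_tdensity K)). Qed.

Definition transition_law (x : X) : giry X R :=
  dens (tdensity_ge0 K x) (measurable_tdensity_section x) (tdensity_int1 K x).

Lemma measurable_transition_law : measurable_fun [set: X] transition_law.
Proof.
apply: measurable_giry_codensity => // B mB.
rewrite (_ : (fun _ => _) = (fun x =>
    \int[mu]_y (((fun z : X * X => (K z.1 z.2)%:E) \_ (setT `*` B)) (x, y)))%E).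
  apply: measurable_fun_fubini_tonelli_F.
    apply/(measurable_restrictT _ _).1; first exact: measurableX.
    apply/measurable_funTS/measurable_EFinP; exact: measurable_tdensity.
  by move=> z; apply: erestrict_ge0 => ? _; rewrite lee_fin tdensity_ge0.
apply/funext => x; rewrite /= /transition_law /dens /= /dens_set.
rewrite integral_mkcond; apply: eq_integral => y _.
rewrite /patch; have -> : ((x, y) \in [set: X] `*` B) = (y \in B) by
  apply/idP/idP; rewrite !inE => //= -[].
by [].
Qed.

(** A measurable family of couplings of [K x] and [K x'], for [x <> x'].
    Nothing is required on the diagonal, where it is not used. *)
Record coupling := Coupling {
  coupling_law :> X * X -> probability (X * X)%type R ;
  measurable_coupling : forall A, measurable A ->
    measurable_fun [set: X * X] (fun z => coupling_law z A) ;
  coupling_fst : forall x x' A, x <> x' -> measurable A ->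
    coupling_law (x, x') (A `*` setT) = transition_law x A ;
  coupling_snd : forall x x' A, x <> x' -> measurable A ->
    coupling_law (x, x') (setT `*` A) = transition_law x' A }.

Variable C : coupling.

Lemma measurable_diag_map : measurable_fun [set: X] (fun x : X => (x, x)).
Proof. exact: measurable_fun_pair. Qed.

(** Law of the pair [(X_t, X~_t)] given [(X_(t-1), X~_(t-1)) = z]. *)
Definition mutate (z : X * X) : giry (X * X)%type R :=
  if `[< z.1 = z.2 >] then giry_map measurable_diag_map (transition_law z.1)
  else C z.

Hypothesis mdiag : measurable [set z : X * X | z.1 = z.2].

Lemma measurable_mutate : measurable_fun [set: X * X] mutate.
Proof.
apply: measurable_fun_ifT.
- apply: (measurable_fun_bool true); rewrite setTI.
  rewrite (_ : _ @^-1` _ = [set z : X * X | z.1 = z.2])//.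
  by apply/seteqP; split=> z /= /asboolP.
- apply: (measurableT_comp (measurable_giry_map measurable_diag_map)).
  by apply: measurableT_comp => //; exact: measurable_transition_law.
- apply: measurable_giry_codensity => // B mB; exact: measurable_coupling.
Qed.

End transition_law.

Section ccpf.
Context d (X : measurableType d) (R : realType).
Variable mu : {sigma_finite_measure set X -> \bar R}.
Variable m : model mu.
Variable C : forall t, coupling (M m t).

(** Without it, neither the test [X = X~] of the mutation step nor the event
    [S = S~] would be measurable. *)
Hypothesis mdiag : measurable [set z : X * X | z.1 = z.2].

(** [n] is the number [N - 1] of particles other than the reference, which
    has index [ord0]. *)
Variable n : nat.

(** [s] and [s'] list the reference trajectories: [x*_t] is [nth point s t.-1]. *)
Variables s s' : seq X.

Notation indices := ('I_n.+1 * 'I_n.+1)%type.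

(** [((X_t^(i), X~_t^(i)), (I_t^(i), I~_t^(i)))]; the ancestor indices have no
    meaning at time [1], where they are set to [ord0]. *)
Notation particle := ((X * X) * indices)%type.

Notation level := (n.+1.-tuple particle).

Definition refs (t : nat) : particle :=
  ((nth point s t.-1, nth point s' t.-1), (ord0, ord0)).

Definition omega t (l : level) (i : 'I_n.+1) : R := G m t (tnth l i).1.1.
Definition omega' t (l : level) (i : 'I_n.+1) : R := G m t (tnth l i).1.2.

(** Law of one pair of indices resampled from the particles [l] of time [t]. *)
Definition resample t (l : level) : giry indices R :=
  @cres R n (omega t l) (omega' t l)
    (fun i => potential_ge0 (G m t) _) (fun i => potential_ge0 (G m t) _).

Lemma measurable_resample t : measurable_fun [set: level] (resample t).
Proof.
apply: measurable_cres => i;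
  (apply: measurableT_comp; first exact: measurable_potential);
  by apply: measurableT_comp => //; apply: measurableT_comp => //;
     exact: measurable_tnth.
Qed.

Definition resamples t (l : level) : giry (n.-tuple indices) R :=
  gtprod [tuple resample t l | i < n].

Lemma measurable_resamples t : measurable_fun [set: level] (resamples t).
Proof.
apply: (measurableT_comp (@measurable_gtprod _ _ R n)).
apply/measurable_fun_tnthP => i.
apply: (eq_measurable_fun (resample t)).
  by move=> l _; rewrite /= tnth_mktuple.
exact: measurable_resample.
Qed.

(** Mutation to time [t], given the particles of time [t - 1] and the selected
    indices. *)
Definition mutates t (li : level * n.-tuple indices) :
    giry (n.-tuple (X * X)) R :=
  gtprod [tuple mutate (C t) ((tnth li.1 (tnth li.2 i).1).1.1,
                              (tnth li.1 (tnth li.2 i).2).1.2) | i < n].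

Lemma measurable_mutates t :
  measurable_fun [set: level * n.-tuple indices] (mutates t).
Proof.
apply: (measurableT_comp (@measurable_gtprod _ _ R n)).
apply/measurable_fun_tnthP => i.
apply: (eq_measurable_fun (mutate (C t) \o (fun li : level * n.-tuple indices =>
    ((tnth li.1 (tnth li.2 i).1).1.1, (tnth li.1 (tnth li.2 i).2).1.2)))).
  by move=> l _; rewrite /= tnth_mktuple.
apply: measurableT_comp; first exact: measurable_mutate.
have mi : measurable_fun [set: level * n.-tuple indices]
    (fun li => tnth li.2 i).
  by apply: (measurableT_comp (measurable_tnth i)).
apply: measurable_fun_pair; (apply: measurableT_comp => //);
  (apply: measurableT_comp => //); apply: measurable_fun_tnth => //;
  exact: measurableT_comp.
Qed.

Definition first_level (xs : n.-tuple X) : level :=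
  [tuple of refs 1 :: [tuple ((tnth xs i, tnth xs i), (ord0, ord0)) | i < n]].

Lemma measurable_first_level : measurable_fun [set: n.-tuple X] first_level.
Proof.
apply: measurable_cons => //; apply/measurable_fun_tnthP => i.
apply: (eq_measurable_fun (fun xs : n.-tuple X =>
    ((tnth xs i, tnth xs i), (ord0 : 'I_n.+1, ord0 : 'I_n.+1)))).
  by move=> l _; rewrite /= tnth_mktuple.
by apply: measurable_fun_pair => //; apply: measurable_fun_pair;
  exact: measurable_tnth.
Qed.

Definition next_level t
    (lix : (level * n.-tuple indices) * n.-tuple (X * X)) : level :=
  [tuple of refs t :: [tuple (tnth lix.2 i, tnth lix.1.2 i) | i < n]].

Lemma measurable_next_level t : measurable_fun
  [set: (level * n.-tuple indices) * n.-tuple (X * X)] (next_level t).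
Proof.
apply: measurable_cons => //; apply/measurable_fun_tnthP => i.
apply: (eq_measurable_fun (fun lix :
    (level * n.-tuple indices) * n.-tuple (X * X) =>
    (tnth lix.2 i, tnth lix.1.2 i))).
  by move=> l _; rewrite /= tnth_mktuple.
apply: measurable_fun_pair; apply: (measurableT_comp (measurable_tnth i)) => //.
exact: measurableT_comp.
Qed.

Definition init : giry level R :=
  giry_map measurable_first_level (gtprod [tuple initial_law m | i < n]).

Definition step t (l : level) : giry level R :=
  giry_map (measurable_next_level t.+1)
    (giry_bind (keep (resamples t) l) (measurable_keep (measurable_mutates t.+1))).

Lemma measurable_step t : measurable_fun [set: level] (step t).
Proof.
apply: (@measurableT_comp _ _ _ _ _ _ (giry_map _)).
  exact: measurable_giry_map.
apply: (@measurableT_comp _ _ _ _ _ _ (fun l => giry_bind l _)).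
  exact: measurable_giry_bind.
by apply: measurable_keep; exact: measurable_resamples.
Qed.

(** A history [h : t.-tuple level] lists the particles of times [t, ..., 1],
    the most recent first. *)
Definition last_level t (h : t.-tuple level) : level := head point h.

Lemma measurable_last_level t :
  measurable_fun [set: t.-tuple level] (@last_level t).
Proof.
case: t => [|t].
  apply: (eq_measurable_fun (cst point)); last exact: measurable_cst.
  by move=> h _; rewrite tuple0.
apply: (eq_measurable_fun (fun h : t.+1.-tuple level => tnth h ord0)).
  by move=> h _; rewrite (tnth_nth point) /last_level nth0.
exact: measurable_tnth.
Qed.

Definition new_level t (h : t.-tuple level) : giry level R :=
  if t is 0 then init else step t (last_level h).

Lemma measurable_new_level t :
  measurable_fun [set: t.-tuple level] (@new_level t).
Proof.
case: t => [|t] /=; first exact: measurable_cst.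
exact: (measurableT_comp (measurable_step t.+1) (@measurable_last_level t.+1)).
Qed.

Fixpoint history t : giry (t.-tuple level) R :=
  match t with
  | 0 => giry_ret [tuple]
  | t'.+1 => giry_map
      (measurable_cons (@measurable_snd _ _ (t'.-tuple level) level)
                       measurable_fst)
      (giry_bind (history t') (measurable_keep (@measurable_new_level t')))
  end.

(** The pairs [(X_t^(J_t), X~_t^(J~_t))] of times [t, ..., 1], where
    [j = (J_t, J~_t)] and the earlier indices are read off the ancestors. *)
Fixpoint lineage t : t.-tuple level -> indices -> t.-tuple (X * X) :=
  match t with
  | 0 => fun _ _ => [tuple]
  | t'.+1 => fun h j =>
      let p := tnth (thead h) j.1 in
      let p' := tnth (thead h) j.2 in
      [tuple of (p.1.1, p'.1.2)
             :: lineage [tuple of behead h] (p.2.1, p'.2.2)]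
  end.

Lemma measurable_lineage t :
  measurable_fun [set: t.-tuple level * indices] (fun hj => lineage hj.1 hj.2).
Proof.
elim: t => [|t IH] /=; first exact: measurable_cst.
have mh : measurable_fun [set: t.+1.-tuple level * indices]
    (fun hj => thead hj.1).
  by apply: (measurableT_comp (measurable_tnth ord0)).
have mp : measurable_fun [set: t.+1.-tuple level * indices]
    (fun hj => tnth (thead hj.1) hj.2.1).
  by apply: measurable_fun_tnth => //; exact: measurableT_comp.
have mp' : measurable_fun [set: t.+1.-tuple level * indices]
    (fun hj => tnth (thead hj.1) hj.2.2).
  by apply: measurable_fun_tnth => //; exact: measurableT_comp.
apply: measurable_cons.
  by apply: measurable_fun_pair; (apply: measurableT_comp => //);
    exact: measurableT_comp.
apply: (@measurableT_comp _ _ _ _ _ _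
  (fun hj : t.-tuple level * indices => lineage hj.1 hj.2) _
  (fun hj : t.+1.-tuple level * indices => ([tuple of behead hj.1],
    ((tnth (thead hj.1) hj.2.1).2.1, (tnth (thead hj.1) hj.2.2).2.2)))) => //.
apply: measurable_fun_pair.
  by apply: (measurableT_comp (@measurable_behead _ _ t)).
by apply: measurable_fun_pair; (apply: measurableT_comp => //);
  exact: measurableT_comp.
Qed.

(** Output [(S, S~)], in chronological order. *)
Definition output T (hj : T.-tuple level * indices) :
    T.-tuple X * T.-tuple X :=
  let p := rev_tuple (lineage hj.1 hj.2) in
  ([tuple (tnth p t).1 | t < T], [tuple (tnth p t).2 | t < T]).

Lemma measurable_output T :
  measurable_fun [set: T.-tuple level * indices] (@output T).
Proof.
have mp (t : 'I_T) : measurable_fun [set: T.-tuple level * indices]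
    (fun hj => tnth (rev_tuple (lineage hj.1 hj.2)) t).
  apply: (eq_measurable_fun (fun hj : T.-tuple level * indices =>
      tnth (lineage hj.1 hj.2) (rev_ord t))).
    move=> hj _; rewrite !(tnth_nth point)/= nth_rev ?size_tuple//.
  apply: (measurableT_comp (measurable_tnth (rev_ord t))).
  exact: measurable_lineage.
apply: measurable_fun_pair; apply/measurable_fun_tnthP => t.
  apply: (eq_measurable_fun (fun hj : T.-tuple level * indices =>
      (tnth (rev_tuple (lineage hj.1 hj.2)) t).1)).
    by move=> hj _; rewrite /= tnth_mktuple.
  exact: measurableT_comp.
apply: (eq_measurable_fun (fun hj : T.-tuple level * indices =>
    (tnth (rev_tuple (lineage hj.1 hj.2)) t).2)).
  by move=> hj _; rewrite /= tnth_mktuple.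
exact: measurableT_comp.
Qed.

Definition final_resample T (h : T.-tuple level) : giry indices R :=
  resample T (last_level h).

Lemma measurable_final_resample T :
  measurable_fun [set: T.-tuple level] (@final_resample T).
Proof.
exact: (measurableT_comp (measurable_resample T) (@measurable_last_level T)).
Qed.

Definition ccpf_law T : giry (T.-tuple X * T.-tuple X)%type R :=
  giry_map (@measurable_output T)
    (giry_bind (history T) (measurable_keep (@measurable_final_resample T))).

End ccpf.

(** Law of the output [(S, S~)]; see [CCPF_setT] for its total mass. *)
Definition CCPF d (X : measurableType d) (R : realType)
    (mu : {sigma_finite_measure set X -> \bar R}) (T : nat) (m : model mu)
    (C : forall t, coupling (M m t))
    (mdiag : measurable [set z : X * X | z.1 = z.2])
    (s s' : T.-tuple X) (N : nat) : giry (T.-tuple X * T.-tuple X)%type R :=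
  ccpf_law C mdiag N.-1 s s' T.

(** [giry] only records subprobabilities. Mass can only be lost when all the
    weights of one time step vanish; when the potentials are positive, the
    output has a genuine probability law. *)

Section mass_primitives.
Context d1 d2 (Y : measurableType d1) (Z : measurableType d2) (R : realType).

Lemma giry_map_setT (f : Y -> Z) (mf : measurable_fun [set: Y] f)
    (P : giry Y R) : giry_map mf P setT = P setT.
Proof. by []. Qed.

Lemma giry_prod_setT (P : giry Y R) (Q : giry Z R) :
  P setT = 1%E -> Q setT = 1%E -> giry_prod (P, Q) setT = 1%E.
Proof.
move=> P1 Q1; rewrite -setXTT -[LHS]/((P \x Q)%E (setT `*` setT)).
by rewrite product_measure1E// [X in (X * _)%E]P1 [X in (_ * X)%E]Q1 mule1.
Qed.

Lemma giry_bind_setT (P : giry Y R) (k : Y -> giry Z R)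
    (mk : measurable_fun [set: Y] k) :
  P setT = 1%E -> (forall y, k y setT = 1%E) -> giry_bind P mk setT = 1%E.
Proof.
move=> P1 k1; rewrite /giry_bind /= /giry_join /=.
rewrite giry_int_map//; last exact: measurable_giry_ev.
rewrite /giry_int (eq_integral (cst 1%E)); last by move=> y _; exact: k1.
by rewrite integral_cst// mul1e.
Qed.

Lemma keep_setT (k : Y -> giry Z R) y : k y setT = 1%E -> keep k y setT = 1%E.
Proof. by move=> k1; apply: giry_prod_setT => //; exact: diracT. Qed.

End mass_primitives.

Lemma gtprod_setT d (Y : measurableType d) (R : realType) n
    (P : n.-tuple (giry Y R)) :
  (forall i, tnth P i setT = 1%E) -> gtprod P setT = 1%E.
Proof.
elim: n P => [|n IH] P P1; first exact: diracT.
apply: (@giry_prod_setT _ _ _ _ R (thead P) (gtprod [tuple of behead P])).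
  exact: P1.
apply: IH => i.
by rewrite -(P1 (lift ord0 i)) [in RHS](tuple_eta P) tnthS.
Qed.

Lemma cres_setT (R : realType) n (w v : 'I_n.+1 -> R)
    (w0 : forall i, 0 <= w i) (v0 : forall i, 0 <= v i) :
  (forall i, 0 < w i) -> (forall i, 0 < v i) -> cres w0 v0 setT = 1%E.
Proof.
have nw1 u : (forall i, 0 < u i) -> \sum_(i < n.+1) nweight u i = 1 :> R.
  move=> u0; rewrite -mulr_suml divff// gt_eqF//.
  rewrite big_ord_recl ltr_pwDl// sumr_ge0// => i _; exact: ltW.
move=> wp vp; rewrite /cres /flaw /= /flaw_set.
under eq_bigr do rewrite diracT mule1.
rewrite sumEFin; congr (_%:E).
rewrite cres_mass_sum /cres_resid -!mulr_suml !sumrB.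
rewrite -/(cres_pc w v) -/(cres_pc v w) !nw1// (cres_pcC v w).
have [pc1|pc1] := eqVneq (1 - cres_pc w v) 0; last first.
  by rewrite divff// !mulr1 subrKC.
by rewrite pc1 mul0r addr0; apply/esym/subr0_eq.
Qed.

Lemma measurable_diag_tuple d (X : measurableType d) (T : nat) :
  measurable [set z : X * X | z.1 = z.2] ->
  measurable [set z : T.-tuple X * T.-tuple X | z.1 = z.2].
Proof.
move=> mdiag; rewrite (_ : [set _ | _] = \bigcap_(i in [set: 'I_T])
  (fun z : T.-tuple X * T.-tuple X => (tnth z.1 i, tnth z.2 i)) @^-1`
    [set z | z.1 = z.2]).
  apply: fin_bigcap_measurable => [|i _]; first exact: finite_finset.
  rewrite -[X in measurable X]setTI.
  suff: measurable_fun [set: T.-tuple X * T.-tuple X]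
    (fun z => (tnth z.1 i, tnth z.2 i)) by exact.
  by apply: measurable_fun_pair; apply: (measurableT_comp (measurable_tnth i)).
apply/seteqP; split=> [[x y] /= -> //|[x y] /= h].
by apply: eq_from_tnth => i; exact: (h i).
Qed.

Section ccpf_mass.
Context d (X : measurableType d) (R : realType).
Variable mu : {sigma_finite_measure set X -> \bar R}.
Variable m : model mu.
Variable C : forall t, coupling (M m t).
Hypothesis mdiag : measurable [set z : X * X | z.1 = z.2].

Lemma mutate_setT t z : mutate (C t) z setT = 1%E.
Proof.
rewrite /mutate; case: ifP => _; last exact: probability_setT.
by rewrite giry_map_setT; exact: tdensity_int1.
Qed.

Lemma CCPF_setT (T : nat) (s s' : T.-tuple X) (N : nat) :
  (1 <= T)%N -> (forall t x, (1 <= t <= T)%N -> 0 < G m t x) ->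
  CCPF C mdiag s s' N setT = 1%E.
Proof.
move=> T1 G0.
have res1 t l : (1 <= t <= T)%N -> resample (n := N.-1) m t l setT = 1%E.
  by move=> tT; apply: cres_setT => i; exact: G0.
have hist1 t : (t <= T)%N -> history C mdiag N.-1 s s' t setT = 1%E.
  elim: t => [|t IH] tT /=; first exact: diracT.
  apply: giry_bind_setT => [|h]; first by apply: IH; exact: ltnW.
  apply: keep_setT; case: t {IH} tT h => [|t] tT h /=.
    apply: gtprod_setT => i.
    by rewrite tnth_mktuple; exact: pdensity_int1.
  apply: giry_bind_setT => [|li].
    apply: keep_setT; apply: gtprod_setT => i.
    by rewrite tnth_mktuple; apply: res1; rewrite /= ltnW.
  apply: keep_setT; apply: gtprod_setT => i.
  by rewrite tnth_mktuple mutate_setT.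
apply: giry_bind_setT => [|h]; first exact: hist1.
by apply: keep_setT; rewrite /final_resample res1// T1 leqnn.
Qed.

End ccpf_mass.

(* Main.v *)
(** Call particle [i] of time [t] good if it is not the reference, if both
    filters gave it the same good ancestor and if it has the same position in
    both; a good final particle yields [S = S~]. Put
    [delta = 1 / (1 + (N - 1) eps)] and let [u_t] be the probability that an
    index drawn with the weights of time [t] of one of the filters is bad.
    Follow backwards in time, in one filter, the lineage of a bad particle.
    It leaves the good set at some time for one of two reasons. Either it hits the
    reference, or it hits a good particle but the resampling drew the two indices
    from the residual laws. Given the positions of time [t + 1], the parent of
    a particle at [y] is the reference with probability
    [G_t(x_1) M(x_1, y) / sum_j G_t(x_j) M(x_j, y) <= delta], whatever the lineage
    does later; no constant is accumulated over time. The residual draw has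
    a probability which does not depend on the position of the particle and which is
    at most the weight of the bad particles in the other filter. Hence
    [u_t <= t delta + sum_(r < t) u_r], that is [u_t <= (2^t - 1) delta], and
    [P(S <> S~) <= 2 u_T <= 2 (2^T - 1) delta <= 2^T T delta]. *)

Require Import Defs.
From HB Require Import structures.
From mathcomp Require Import all_boot all_order all_algebra.
From mathcomp Require Import all_classical all_reals all_analysis.
From mathcomp Require Import measurable_realfun giry.
From mathcomp Require Import ring lra.

Set Implicit Arguments.
Unset Strict Implicit.
Unset Printing Implicit Defensive.
Import Order.TTheory GRing.Theory Num.Theory.
Import numFieldNormedType.Exports.
Local Open Scope classical_set_scope.
Local Open Scope ring_scope.

(** * Integrals against composed kernels, product laws and finite laws *)

Section giry_integrals.
Local Open Scope ereal_scope.
Context d (Y : measurableType d) d2 (Z : measurableType d2) (R : realType).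

Lemma le_giry_int (P : giry Y R) (f g : Y -> \bar R) :
  measurable_fun setT f -> measurable_fun setT g ->
  (forall y, 0 <= f y) -> (forall y, f y <= g y) ->
  giry_int P f <= giry_int P g.
Proof.
by move=> mf mg f0 fg; apply: ge0_le_integral.
Qed.

Lemma giry_int_cst_le (P : giry Y R) (f : Y -> \bar R) c :
  measurable_fun setT f -> (forall y, 0 <= f y) -> (forall y, f y <= c) ->
  giry_int P f <= c.
Proof.
move=> mf f0 fc; have c0 : 0 <= c by exact: le_trans (f0 point) (fc point).
apply: (@le_trans _ _ (giry_int P (cst c))); first exact: le_giry_int.
rewrite /giry_int integral_cst//; apply: (@le_trans _ _ (c * 1)).
  by apply: lee_wpmul2l => //; exact: sprobability_setT.
by rewrite mule1.
Qed.

Lemma giry_int_keep (k : Y -> giry Z R) (y : Y) (f : Y * Z -> \bar R) :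
  measurable_fun setT f -> (forall p, 0 <= f p) ->
  giry_int (keep k y) f = giry_int (k y) (fun z => f (y, z)).
Proof.
move=> mf f0; rewrite /keep giry_int_prod1// giry_int_ret//.
have mk : measurable_fun setT (cst (k y) : Y -> giry Z R) by exact: measurable_cst.
exact: measurable_fun_fubini_tonelli_F.
Qed.

(** Both the kernel and the integrand depend on [y]. Integrating the fixed [f] against [keep k y]
    moves the second dependence into the law, where [measurable_keep] applies. *)
Lemma measurable_giry_int_param (k : Y -> giry Z R) (f : Y * Z -> \bar R) :
  measurable_fun setT k -> measurable_fun setT f -> (forall p, 0 <= f p) ->
  measurable_fun setT (fun y => giry_int (k y) (fun z => f (y, z))).
Proof.
move=> mk mf f0.
apply: (eq_measurable_fun (fun y => giry_int (keep k y) f)).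
  by move=> y _; rewrite giry_int_keep.
apply: (@measurableT_comp _ _ _ _ _ _ (giry_int ^~ f) _ (keep k)).
  exact: measurable_giry_int.
exact: measurable_keep.
Qed.

Lemma giry_int_bind_keep (P : giry Y R) (k : Y -> giry Z R)
    (mk : measurable_fun setT k) (f : Y * Z -> \bar R) :
  measurable_fun setT f -> (forall p, 0 <= f p) ->
  giry_int (giry_bind P (measurable_keep mk)) f =
  giry_int P (fun y => giry_int (k y) (fun z => f (y, z))).
Proof.
move=> mf f0; rewrite giry_int_bind//.
by apply: eq_integral => y _; rewrite giry_int_keep.
Qed.

End giry_integrals.

Lemma giry_int_gtprodS d (Y : measurableType d) (R : realType) n
    (P : n.+1.-tuple (giry Y R)) (f : n.+1.-tuple Y -> \bar R) :
  measurable_fun setT f -> (forall v, 0 <= f v)%E ->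
  giry_int (gtprod P) f = giry_int (thead P) (fun y =>
    giry_int (gtprod [tuple of behead P]) (fun v => f [tuple of y :: v])).
Proof.
move=> mf f0 /=; rewrite giry_int_map// giry_int_prod1//.
  by apply: measurableT_comp => //; exact: measurable_cons.
by move=> v; exact: f0.
Qed.

Lemma giry_int_flaw d (I : measurableType d) (R : realType) (J : finType)
    (f : J -> I) (q : J -> R) (q0 : forall i, 0 <= q i)
    (q1 : \sum_i q i <= 1) (h : I -> \bar R) :
  measurable_fun setT h -> (forall x, 0 <= h x)%E ->
  (giry_int (flaw f q0 q1) h = \sum_i (q i)%:E * h (f i))%E.
Proof.
(* The law becomes a sum of [#|J|] scaled point masses. Finite sums of measures are indexed by
   natural numbers, so [m_] goes through the enumeration of [J] and is null beyond it. *)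
move=> mh h0; pose m_ k : {measure set I -> \bar R} :=
  if insub k is Some j then mscale (NngNum (q0 (enum_val (j : 'I_#|J|))))
    (\d_(f (enum_val j)) : {measure set I -> \bar R}) else mzero.
rewrite /giry_int (@eq_measure_integral _ _ _ setT (msum m_ #|J|)).
  rewrite ge0_integral_measure_sum// [RHS]big_enum_val; apply: eq_bigr => j _.
  by rewrite /m_ valK ge0_integral_mscale//= integral_dirac// diracT mul1e.
move=> A mA _; rewrite /flaw /= /flaw_set /msum /= [LHS]big_enum_val.
by apply: eq_bigr => j _; rewrite /m_ valK.
Qed.

(** * Integration against a law given by a density *)

Section density_integral.
Local Open Scope ereal_scope.
Context d (X : measurableType d) (R : realType).
Variables (mu : {measure set X -> \bar R}) (f : X -> R).
Hypothesis f_ge0 : forall x, (0 <= f x)%R.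
Hypothesis mf : measurable_fun [set: X] f.
Hypothesis f_int1 : (\int[mu]_x (f x)%:E = 1)%E.

Import HBNNSimple.

(** Both sides are limits along simple functions increasing to [h], by monotone convergence. For a
    simple function the identity reduces, level set by level set, to the definition of
    [dens_set]. *)
Lemma giry_int_dens (h : X -> \bar R) :
  measurable_fun setT h -> (forall x, 0 <= h x) ->
  giry_int (dens f_ge0 mf f_int1) h = \int[mu]_x ((f x)%:E * h x).
Proof.
move=> mh h0; pose g := nnsfun_approx measurableT mh.
have mf' : measurable_fun [set: X] (EFin \o f) by exact/measurable_EFinP.
have hlim x : h x = limn (fun n => (g n x)%:E).
  by apply/esym/cvg_lim => //; exact: cvg_nnsfun_approx.
transitivity (limn (fun n => \int[dens f_ge0 mf f_int1]_x (g n x)%:E)).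
  rewrite -monotone_convergence//.
  - by apply: eq_integral => x _; exact: hlim.
  - by move=> n; exact/measurable_EFinP.
  - by move=> n x _; rewrite lee_fin.
  - by move=> x _ a b ab; rewrite lee_fin; exact/lefP/nd_nnsfun_approx.
transitivity (limn (fun n => \int[mu]_x ((f x)%:E * (g n x)%:E))); last first.
  rewrite -monotone_convergence//.
  - apply: eq_integral => x _; apply/cvg_lim => //.
    by apply: cvgeZl => //; exact: cvg_nnsfun_approx.
  - by move=> n; apply: emeasurable_funM => //; exact/measurable_EFinP.
  - by move=> n x _; rewrite mule_ge0// lee_fin.
  - move=> x _ a b ab; rewrite lee_wpmul2l ?lee_fin//.
    exact/lefP/nd_nnsfun_approx.
apply: congr_lim; apply/funext => n.
transitivity (\int[mu]_x (\sum_(y \in range (g n))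
    ((f x)%:E * (y * \1_(g n @^-1` [set y]) x)%:E))); last first.
  apply: eq_integral => x _; rewrite -ge0_mule_fsumr; last first.
    by move=> y; exact: nnfun_muleindic_ge0.
  by rewrite fsumEFin// -fimfunE.
rewrite integralT_nnsfun sintegralE ge0_integral_fsum//; last 2 first.
- move=> y; apply: emeasurable_funM => //; apply/measurable_EFinP.
  exact: measurable_funM.
- move=> y x _; apply: mule_ge0; first by rewrite lee_fin.
  exact: nnfun_muleindic_ge0.
apply: eq_fsbigr => r /[!inE] -[x0 _ <-].
under [RHS]eq_integral do rewrite EFinM muleCA.
rewrite ge0_integralZl//=.
- congr (_ * _); rewrite /dens_set integral_mkcond; apply: eq_integral => x _.
  by rewrite epatch_indic.
- apply: emeasurable_funM => //; apply/measurable_EFinP.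
  exact: measurable_indic.
- by move=> x _; rewrite mule_ge0// lee_fin.
- by rewrite lee_fin.
Qed.

End density_integral.

(** * Iterated integrals against products of densities *)

Lemma measurable_bigprod d (Y : measurableType d) (R : realType) n
    (f : 'I_n -> Y -> R) : (forall k, measurable_fun setT (f k)) ->
  measurable_fun setT (fun y => \prod_(k < n) f k y).
Proof.
elim: n f => [|n IH] f mf.
  by apply: (eq_measurable_fun (fun _ : Y => 1 : R)) => // y _; rewrite big_ord0.
apply: (eq_measurable_fun (fun y => f ord0 y * \prod_(k < n) f (lift ord0 k) y)).
  by move=> y _; rewrite big_ord_recl.
by apply: measurable_funM => //; exact: IH.
Qed.

Section iterated_integral.
Local Open Scope ereal_scope.
Context d (X : measurableType d) (R : realType).
Variable mu : {sigma_finite_measure set X -> \bar R}.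

(** The integral of [g] against the product of the densities [F k], kept nested so that peeling off
    the first coordinate follows the recursion of [gtprod]. *)
Fixpoint iint n : ('I_n -> X -> R) -> (n.-tuple X -> \bar R) -> \bar R :=
  match n with
  | 0 => fun _ g => g [tuple]
  | n'.+1 => fun F g => \int[mu]_x ((F ord0 x)%:E *
      iint (fun k => F (lift ord0 k)) (fun v => g [tuple of x :: v]))
  end.

Lemma iintS n (F : 'I_n.+1 -> X -> R) (g : n.+1.-tuple X -> \bar R) :
  iint F g = \int[mu]_x ((F ord0 x)%:E *
    iint (fun k => F (lift ord0 k)) (fun v => g [tuple of x :: v])).
Proof. by []. Qed.

Lemma iint_ge0 n (F : 'I_n -> X -> R) (g : n.-tuple X -> \bar R) :
  (forall k x, 0 <= F k x)%R -> (forall v, 0 <= g v) -> 0 <= iint F g.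
Proof.
elim: n F g => [|n IH] F g F0 g0 //=.
by apply: integral_ge0 => x _; rewrite mule_ge0 ?lee_fin//; exact: IH.
Qed.

(** The parameter space is arbitrary for the sake of the induction: the first coordinate joins the
    parameter, which then lives in [P * X]. *)
Lemma measurable_iint d' (P : measurableType d') n
    (F : 'I_n -> P -> X -> R) (g : P -> n.-tuple X -> \bar R) :
  (forall k p x, 0 <= F k p x)%R -> (forall p v, 0 <= g p v) ->
  (forall k, measurable_fun [set: P * X] (fun z => F k z.1 z.2)) ->
  measurable_fun [set: P * n.-tuple X] (fun z => g z.1 z.2) ->
  measurable_fun [set: P] (fun p => iint (fun k => F k p) (g p)).
Proof.
elim: n d' P F g => [|n IH] d' P F g F0 g0 mF mg /=.
  by apply: (measurable_fun_pair1 [tuple] mg).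
pose H (z : P * X) := (F ord0 z.1 z.2)%:E *
  iint (fun k => F (lift ord0 k) z.1) (fun v => g z.1 [tuple of z.2 :: v]).
apply: (@measurable_fun_fubini_tonelli_F _ _ _ _ _ mu H) => [|z]; last first.
  by rewrite mule_ge0 ?lee_fin//; exact: iint_ge0.
apply: emeasurable_funM; first exact/measurable_EFinP.
apply: (IH _ (P * X)%type (fun k z => F (lift ord0 k) z.1)
  (fun z v => g z.1 [tuple of z.2 :: v])) => //.
- move=> k; have mpair : measurable_fun [set: (P * X) * X]
      (fun z => (z.1.1, z.2)).
    by apply: measurable_fun_pair => //; exact: measurableT_comp.
  exact: (measurableT_comp (mF (lift ord0 k)) mpair).
- have mpair : measurable_fun [set: (P * X) * n.-tuple X]
      (fun z => (z.1.1, [tuple of z.1.2 :: z.2])).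
    apply: measurable_fun_pair; first exact: measurableT_comp.
    by apply: measurable_cons => //; exact: measurableT_comp.
  exact: (measurableT_comp mg mpair).
Qed.

Section fixed_densities.
Variables (n : nat) (F : 'I_n.+1 -> X -> R).
Hypothesis F0 : forall k x, (0 <= F k x)%R.
Hypothesis mF : forall k, measurable_fun setT (F k).

Lemma measurable_iint_tail (g : n.+1.-tuple X -> \bar R) :
  measurable_fun setT g -> (forall v, 0 <= g v) ->
  measurable_fun setT (fun x =>
    iint (fun k => F (lift ord0 k)) (fun v => g [tuple of x :: v])).
Proof.
move=> mg g0; apply: (measurable_iint (F := fun k _ => F (lift ord0 k))
  (g := fun x v => g [tuple of x :: v])) => //.
  by move=> k; exact: measurableT_comp.
have mcons : measurable_fun [set: X * n.-tuple X] (fun z => [tuple of z.1 :: z.2]).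
  exact: measurable_cons.
exact: (measurableT_comp mg mcons).
Qed.

Lemma measurable_iint_integrand (g : n.+1.-tuple X -> \bar R) :
  measurable_fun setT g -> (forall v, 0 <= g v) ->
  measurable_fun setT (fun x => (F ord0 x)%:E *
    iint (fun k => F (lift ord0 k)) (fun v => g [tuple of x :: v])).
Proof.
move=> mg g0; apply: emeasurable_funM; first exact/measurable_EFinP.
exact: measurable_iint_tail.
Qed.

Lemma iint_integrand_ge0 (g : n.+1.-tuple X -> \bar R) x :
  (forall v, 0 <= g v) -> 0 <= (F ord0 x)%:E *
    iint (fun k => F (lift ord0 k)) (fun v => g [tuple of x :: v]).
Proof. by move=> g0; rewrite mule_ge0 ?lee_fin//; exact: iint_ge0. Qed.

End fixed_densities.

Lemma measurable_cons_section n (g : n.+1.-tuple X -> \bar R) (x : X) :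
  measurable_fun setT g ->
  measurable_fun setT (fun v : n.-tuple X => g [tuple of x :: v]).
Proof.
move=> mg; have mcons : measurable_fun setT (fun v : n.-tuple X => [tuple of x :: v]).
  exact: measurable_cons.
exact: (measurableT_comp mg mcons).
Qed.

Lemma le_iint n (F : 'I_n -> X -> R) (g g' : n.-tuple X -> \bar R) :
  (forall k x, 0 <= F k x)%R -> (forall k, measurable_fun setT (F k)) ->
  measurable_fun setT g -> measurable_fun setT g' ->
  (forall v, 0 <= g v) -> (forall v, g v <= g' v) -> iint F g <= iint F g'.
Proof.
elim: n F g g' => [|n IH] F g g' F0 mF mg mg' g0 gg' //=.
have g'0 v : 0 <= g' v by exact: le_trans (g0 v) (gg' v).
apply: ge0_le_integral => //.
- by move=> x _; exact: iint_integrand_ge0.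
- exact: measurable_iint_integrand.
- exact: measurable_iint_integrand.
- move=> x _; rewrite lee_wpmul2l ?lee_fin//.
  by apply: IH => //; exact: measurable_cons_section.
Qed.

Lemma iint_cst1 n (F : 'I_n -> X -> R) :
  (forall k x, 0 <= F k x)%R -> (forall k, measurable_fun setT (F k)) ->
  (forall k, \int[mu]_x (F k x)%:E = 1) -> iint F (cst 1) = 1.
Proof.
elim: n F => [|n IH] F F0 mF F1 //=.
by under eq_integral do rewrite IH// mule1.
Qed.

Lemma iint_sum n (F : 'I_n -> X -> R) (J : finType)
    (g : J -> n.-tuple X -> \bar R) :
  (forall k x, 0 <= F k x)%R -> (forall k, measurable_fun setT (F k)) ->
  (forall j, measurable_fun setT (g j)) -> (forall j v, 0 <= g j v) ->
  iint F (fun v => \sum_j g j v) = \sum_j iint F (g j).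
Proof.
elim: n F g => [|n IH] F g F0 mF mg g0 //=.
under eq_integral => x _.
  rewrite IH//; last by move=> j; exact: measurable_cons_section.
  rewrite ge0_sume_distrr; last by move=> j _; exact: iint_ge0.
  over.
rewrite ge0_integral_sum//.
- by move=> j; exact: measurable_iint_integrand.
- by move=> j x _; exact: iint_integrand_ge0.
Qed.

Definition fupd n (F : 'I_n -> X -> R) i D : 'I_n -> X -> R :=
  fun k => if k == i then D else F k.

Lemma fupd_id n (F : 'I_n -> X -> R) i : fupd F i (F i) = F.
Proof. by apply/funext => k; rewrite /fupd; case: eqP => [->|]. Qed.

Lemma fupd_ge0 n (F : 'I_n -> X -> R) i D : (forall k x, 0 <= F k x)%R ->
  (forall x, 0 <= D x)%R -> forall k x, (0 <= fupd F i D k x)%R.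
Proof. by move=> F0 D0 k x; rewrite /fupd; case: eqP. Qed.

Lemma measurable_fupd n (F : 'I_n -> X -> R) i D :
  (forall k, measurable_fun setT (F k)) -> measurable_fun setT D ->
  forall k, measurable_fun setT (fupd F i D k).
Proof. by move=> mF mD k; rewrite /fupd; case: eqP. Qed.

(** Linearity in one factor of the product of densities. The coordinates before [i] are crossed by
    induction; at coordinate [i] the sum leaves the integral. *)
Lemma iint_fupd_sum n (F : 'I_n -> X -> R) i (J : finType) (c : J -> R)
    (D : J -> X -> R) (g : n.-tuple X -> \bar R) :
  (forall k x, 0 <= F k x)%R -> (forall k, measurable_fun setT (F k)) ->
  (forall j, 0 <= c j)%R -> (forall j x, 0 <= D j x)%R ->
  (forall j, measurable_fun setT (D j)) ->
  measurable_fun setT g -> (forall v, 0 <= g v) ->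
  iint (fupd F i (fun x => \sum_j c j * D j x)%R) g =
  \sum_j (c j)%:E * iint (fupd F i (D j)) g.
Proof.
elim: n F i g => [|n IH] F i g F0 mF c0 D0 mD mg g0; first by case: i.
have mI j : measurable_fun setT (fun x => (fupd F i (D j) ord0 x)%:E *
    iint (fun k => fupd F i (D j) (lift ord0 k)) (fun v => g [tuple of x :: v])).
  by apply: measurable_iint_integrand => //; [exact: fupd_ge0|exact: measurable_fupd].
have I0 j x : 0 <= (fupd F i (D j) ord0 x)%:E *
    iint (fun k => fupd F i (D j) (lift ord0 k)) (fun v => g [tuple of x :: v]).
  by apply: iint_integrand_ge0 => //; exact: fupd_ge0.
under [RHS]eq_bigr => j _ do rewrite iintS -ge0_integralZl// ?lee_fin//.
rewrite -ge0_integral_sum//; last 2 first.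
- by move=> j; exact: measurable_funeM.
- by move=> j x _; rewrite mule_ge0 ?lee_fin.
rewrite iintS; apply: eq_integral => x _.
have [k ->|->] := unliftP ord0 i.
  have fl E : (fun k' => fupd F (lift ord0 k) E (lift ord0 k')) =
      fupd (fun k => F (lift ord0 k)) k E.
    by apply/funext => k'; rewrite /fupd (inj_eq lift_inj).
  rewrite fl IH//; last exact: measurable_cons_section.
  rewrite ge0_sume_distrr; last first.
    move=> j _; rewrite mule_ge0 ?lee_fin//; apply: iint_ge0 => //.
    exact: fupd_ge0.
  by apply: eq_bigr => j _; rewrite fl muleCA.
have fl E : (fun k' => fupd F ord0 E (lift ord0 k')) =
    (fun k => F (lift ord0 k)) by [].
rewrite /fupd /= -sumEFin ge0_sume_distrl; last first.
  by move=> j _; rewrite lee_fin mulr_ge0.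
by apply: eq_bigr => j _; rewrite EFinM muleA.
Qed.

Context d1 (Y : measurableType d1) d2 (Z : measurableType d2).
Variables (K : Y -> giry Z R) (mK : measurable_fun setT K).
Variables (pr : Z -> X) (mpr : measurable_fun setT pr).

(** In the application [ys] are the selected index pairs, [zs] the mutated pairs of positions and
    [pr] the projection to one filter. [B k] is an indicator attached to draw [k], while [g] sees
    one filter only. *)
Definition weighted_draw n (B : 'I_n -> Y * Z -> R)
    (g : n.-tuple X -> \bar R) (ys : n.-tuple Y) (zs : n.-tuple Z) : \bar R :=
  (\prod_(k < n) B k (tnth ys k, tnth zs k))%:E * g (map_tuple pr zs).

Lemma weighted_draw_ge0 n (B : 'I_n -> Y * Z -> R) g ys zs :
  (forall k p, 0 <= B k p)%R -> (forall v, 0 <= g v) ->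
  0 <= weighted_draw B g ys zs.
Proof. by move=> B0 g0; rewrite mule_ge0 ?lee_fin ?prodr_ge0. Qed.

Lemma measurable_map_pr n :
  measurable_fun setT (fun zs : n.-tuple Z => map_tuple pr zs).
Proof.
apply/measurable_fun_tnthP => k.
apply: (eq_measurable_fun (fun zs : n.-tuple Z => pr (tnth zs k))).
  by move=> zs _ /=; rewrite tnth_map.
by apply: measurableT_comp => //; exact: measurable_tnth.
Qed.

Lemma measurable_weighted_draw n (B : 'I_n -> Y * Z -> R)
    (g : n.-tuple X -> \bar R) :
  (forall k, measurable_fun setT (B k)) -> measurable_fun setT g ->
  measurable_fun setT (fun p => weighted_draw B g p.1 p.2).
Proof.
move=> mB mg; apply: emeasurable_funM.
  apply/measurable_EFinP; apply: measurable_bigprod => k.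
  have mpair : measurable_fun [set: n.-tuple Y * n.-tuple Z]
      (fun p => (tnth p.1 k, tnth p.2 k)).
    by apply: measurable_fun_pair; apply: (measurableT_comp (measurable_tnth k)).
  exact: (measurableT_comp (mB k) mpair).
have mpr2 : measurable_fun [set: n.-tuple Y * n.-tuple Z]
    (fun p => map_tuple pr p.2).
  exact: (measurableT_comp (@measurable_map_pr n) measurable_snd).
exact: (measurableT_comp mg mpr2).
Qed.

Lemma weighted_draw_cons n (B : 'I_n.+1 -> Y * Z -> R)
    (g : n.+1.-tuple X -> \bar R) (y : Y) (z : Z)
    (ys : n.-tuple Y) (zs : n.-tuple Z) :
  weighted_draw B g [tuple of y :: ys] [tuple of z :: zs] =
  (B ord0 (y, z))%:E * weighted_draw (fun k => B (lift ord0 k))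
    (fun v => g [tuple of pr z :: v]) ys zs.
Proof.
rewrite /weighted_draw big_ord_recl EFinM -muleA; congr (_ * (_%:E * g _)).
  by apply: eq_bigr => k _; rewrite !tnthS.
by apply/val_inj.
Qed.

Lemma measurable_gtprod_map n :
  measurable_fun setT (fun ys : n.-tuple Y => gtprod (map_tuple K ys)).
Proof.
apply: (measurableT_comp (@measurable_gtprod _ _ R n)).
apply/measurable_fun_tnthP => k.
apply: (eq_measurable_fun (fun zs : n.-tuple Y => K (tnth zs k))).
  by move=> zs _ /=; rewrite tnth_map.
by apply: measurableT_comp => //; exact: measurable_tnth.
Qed.

(** Indices and positions come as two successive products, but the factor [B k] involves draw [k]
    only. Exchanging integrals regroups the index and the position of each draw, and the dominations
    assumed for the single draws multiply. *)
Lemma gtprod_draw_le n (P : n.-tuple (giry Y R)) (B : 'I_n -> Y * Z -> R)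
    (F : 'I_n -> X -> R) (g : n.-tuple X -> \bar R) :
  (forall k p, 0 <= B k p)%R -> (forall k, measurable_fun setT (B k)) ->
  (forall k x, 0 <= F k x)%R -> (forall k, measurable_fun setT (F k)) ->
  (forall k f, measurable_fun setT f -> (forall x, 0 <= f x) ->
    giry_int (tnth P k) (fun y => giry_int (K y) (fun z =>
      (B k (y, z))%:E * f (pr z))) <= \int[mu]_x ((F k x)%:E * f x)) ->
  measurable_fun setT g -> (forall v, 0 <= g v) ->
  giry_int (gtprod P) (fun ys =>
    giry_int (gtprod (map_tuple K ys)) (weighted_draw B g ys)) <= iint F g.
Proof.
elim: n P B F g => [|n IH] P B F g B0 mB F0 mF BF mg g0.
  rewrite /= giry_int_ret; last first.
    apply: (@measurable_giry_int_param _ _ _ _ _ (fun ys => gtprod (map_tuple K ys))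
      (fun p => weighted_draw B g p.1 p.2)).
    - exact: measurable_gtprod_map.
    - exact: measurable_weighted_draw.
    - by move=> p; apply: weighted_draw_ge0 => [k q|v]; [exact: B0|exact: g0].
  rewrite giry_int_ret; last exact: (measurable_fun_pair2 _
    (measurable_weighted_draw mB mg)).
  rewrite /weighted_draw big_ord0 mul1e.
  by rewrite (_ : map_tuple _ _ = [tuple])//; exact: val_inj.
pose B' k := B (lift ord0 k); pose F' k := F (lift ord0 k).
pose g' x (v : n.-tuple X) := g [tuple of x :: v].
have mB' k : measurable_fun setT (B' k) by exact: mB.
have B'0 k p : (0 <= B' k p)%R by exact: B0.
have F'0 k x : (0 <= F' k x)%R by exact: F0.
have mF' k : measurable_fun setT (F' k) by exact: mF.
have g'0 x v : 0 <= g' x v by exact: g0.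
have mg' x : measurable_fun setT (g' x) by exact: measurable_cons_section.
have mtail z : measurable_fun setT (fun p : n.-tuple Y * n.-tuple Z =>
    weighted_draw B' (g' (pr z)) p.1 p.2).
  exact: measurable_weighted_draw.
have mW := measurable_weighted_draw mB mg.
(* The integral over the remaining positions, once all the indices and the first position [q.2] are
   fixed. *)
pose H (y : Y) (q : n.-tuple Y * Z) := giry_int (gtprod (map_tuple K q.1))
  (fun zs => weighted_draw B g [tuple of y :: q.1] [tuple of q.2 :: zs]).
have H0 y q : 0 <= H y q.
  by apply: integral_ge0 => zs _; exact: weighted_draw_ge0.
have mH' : measurable_fun [set: Y * (n.-tuple Y * Z)] (fun p => H p.1 p.2).
  apply: (@measurable_giry_int_param _ (Y * (n.-tuple Y * Z))%type _ _ _
    (fun p => gtprod (map_tuple K p.2.1)) (fun p => weighted_draw B g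
    [tuple of p.1.1 :: p.1.2.1] [tuple of p.1.2.2 :: p.2])).
  - have m1 : measurable_fun [set: Y * (n.-tuple Y * Z)] (fun p => p.2.1).
      exact: measurableT_comp.
    exact: (measurableT_comp (@measurable_gtprod_map n) m1).
  - have m2 : measurable_fun [set: (Y * (n.-tuple Y * Z)) * n.-tuple Z]
        (fun p => ([tuple of p.1.1 :: p.1.2.1], [tuple of p.1.2.2 :: p.2])).
      apply: measurable_fun_pair; apply: measurable_cons => //.
      - exact: measurableT_comp.
      - by do 2 apply: measurableT_comp => //.
      - by do 2 apply: measurableT_comp => //.
    exact: (measurableT_comp mW m2).
  - by move=> p; apply: weighted_draw_ge0 => [k q|v]; [exact: B0|exact: g0].
have mH y : measurable_fun setT (H y) by exact: (measurable_fun_pair2 y mH').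
have mKK y : measurable_fun setT (cst (K y) : n.-tuple Y -> giry Z R).
  exact: measurable_cst.
have mHint : measurable_fun setT (fun y =>
    giry_int (gtprod [tuple of behead P]) (fun ys =>
      giry_int (K y) (fun z => H y (ys, z)))).
  apply: (@measurable_giry_int_param _ _ _ _ _
    (fun=> gtprod [tuple of behead P])
    (fun p => giry_int (K p.1) (fun z => H p.1 (p.2, z)))).
  - exact: measurable_cst.
  - apply: (@measurable_giry_int_param _ (Y * n.-tuple Y)%type _ _ _
      (fun p => K p.1) (fun p => H p.1.1 (p.1.2, p.2))).
    + exact: measurableT_comp.
    + have m3 : measurable_fun [set: (Y * n.-tuple Y) * Z]
          (fun p => (p.1.1, (p.1.2, p.2))).
        apply: measurable_fun_pair; first exact: measurableT_comp.
        by apply: measurable_fun_pair => //; exact: measurableT_comp.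
      exact: (measurableT_comp mH' m3).
    + by [].
  - by move=> p; exact: integral_ge0.
have mLint : measurable_fun setT (fun ys : n.+1.-tuple Y =>
    giry_int (gtprod (map_tuple K ys)) (weighted_draw B g ys)).
  apply: (@measurable_giry_int_param _ _ _ _ _ (fun ys => gtprod (map_tuple K ys))
      (fun p => weighted_draw B g p.1 p.2)) => //.
  - exact: measurable_gtprod_map.
  - by move=> p; apply: weighted_draw_ge0 => [k q|v]; [exact: B0|exact: g0].
rewrite giry_int_gtprodS//; last first.
  by move=> ys; apply: integral_ge0 => zs _; exact: weighted_draw_ge0.
have -> : giry_int (thead P) (fun y => giry_int (gtprod [tuple of behead P])
      (fun ys => giry_int (gtprod (map_tuple K [tuple of y :: ys]))
        (weighted_draw B g [tuple of y :: ys]))) =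
    giry_int (thead P) (fun y => giry_int (gtprod [tuple of behead P])
      (fun ys => giry_int (K y) (fun z => H y (ys, z)))).
  apply: eq_integral => y _; apply: eq_integral => ys _.
  rewrite giry_int_gtprodS//; last 2 first.
  - exact: (measurable_fun_pair2 [tuple of y :: ys] mW).
  - by move=> v; exact: weighted_draw_ge0.
  rewrite (_ : thead _ = K y); last by rewrite /thead tnth_map.
  apply: eq_integral => z _; rewrite /H.
  by congr (giry_int (gtprod _) _); exact: val_inj.
apply: (@le_trans _ _ (giry_int (thead P) (fun y => giry_int (K y)
    (fun z => (B ord0 (y, z))%:E * iint F' (g' (pr z)))))); last first.
  rewrite iintS; apply: (BF ord0) => [|x].
    exact: (measurable_iint_tail F0 mF mg g0).
  exact: iint_ge0.
have miint : measurable_fun setT (fun x => iint F' (g' x)).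
  exact: (measurable_iint_tail F0 mF mg g0).
have iint0 x : 0 <= iint F' (g' x).
  by apply: iint_ge0 => [k x'|v]; [exact: F0|exact: g0].
have mBi : measurable_fun [set: Y * Z]
    (fun p => (B ord0 p)%:E * iint F' (g' (pr p.2))).
  apply: emeasurable_funM; first exact/measurable_EFinP.
  have mpr2 : measurable_fun [set: Y * Z] (fun p => pr p.2).
    exact: measurableT_comp.
  exact: (measurableT_comp miint mpr2).
have Bi0 p : 0 <= (B ord0 p)%:E * iint F' (g' (pr p.2)).
  by rewrite mule_ge0// lee_fin.
apply: le_giry_int => //.
- apply: (@measurable_giry_int_param _ _ _ _ _ K (fun p =>
    (B ord0 p)%:E * iint F' (g' (pr p.2)))) => //.
- by move=> y; apply: integral_ge0 => ys _; exact: integral_ge0.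
(* Tonelli: the first position [z] is now drawn before the remaining indices [ys], so that its
   factor leaves the inner integrals and the induction hypothesis applies. *)
move=> y; rewrite -giry_int_prod1// giry_int_prod2//.
apply: le_giry_int => //.
- apply: (@measurable_giry_int_param _ _ _ _ _
    (fun=> gtprod [tuple of behead P]) (fun p => H y (p.2, p.1))) => //.
  have msw : measurable_fun [set: Z * n.-tuple Y] (fun p => (p.2, p.1)).
    exact: measurable_fun_pair.
  exact: (measurableT_comp (mH y) msw).
- exact: (measurable_fun_pair2 y mBi).
- by move=> z; exact: integral_ge0.
move=> z.
have mI : measurable_fun setT (fun ys : n.-tuple Y =>
    giry_int (gtprod (map_tuple K ys)) (weighted_draw B' (g' (pr z)) ys)).
  apply: (@measurable_giry_int_param _ _ _ _ _ (fun ys => gtprod (map_tuple K ys))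
      (fun p => weighted_draw B' (g' (pr z)) p.1 p.2)) => //.
  - exact: measurable_gtprod_map.
  - by move=> p; apply: weighted_draw_ge0 => [k q|v]; [exact: B0|exact: g0].
apply: (@le_trans _ _ ((B ord0 (y, z))%:E * giry_int (gtprod [tuple of behead P])
    (fun ys => giry_int (gtprod (map_tuple K ys))
      (weighted_draw B' (g' (pr z)) ys)))).
  rewrite /giry_int -ge0_integralZl//; last 2 first.
  - move=> ys _; apply: integral_ge0 => zs _.
    by apply: weighted_draw_ge0 => [k q|v]; [exact: B0|exact: g0].
  - by rewrite lee_fin.
  rewrite le_eqVlt; apply/orP; left; apply/eqP.
  apply: eq_integral => ys _; rewrite -ge0_integralZl//; last 3 first.
  - exact: (measurable_fun_pair2 ys (mtail z)).
  - by move=> zs _; apply: weighted_draw_ge0 => [k q|v]; [exact: B0|exact: g0].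
  - by rewrite lee_fin.
  by apply: eq_integral => zs _; rewrite weighted_draw_cons.
rewrite lee_wpmul2l ?lee_fin//; apply: IH => // k f mf f0.
have := BF (lift ord0 k) f mf f0.
by rewrite [in X in X <= _ -> _](tuple_eta P) tnthS.
Qed.

End iterated_integral.

(** The boolean names the filter, [false] for the one with reference [s] and [true] for the one with
    [s'], so that one estimate covers both. *)
Definition side (A : Type) (b : bool) (p : A * A) : A := if b then p.2 else p.1.

Lemma measurable_side d (A : measurableType d) b :
  measurable_fun [set: A * A] (side b).
Proof. by case: b; [exact: measurable_snd|exact: measurable_fst]. Qed.

(** * Coupled resampling: marginals and probability of a bad pair of indices *)

Section coupled_resampling.
Context (R : realType) (n : nat).
Implicit Types w v : 'I_n.+1 -> R.

Lemma cres_massC w v a a' : cres_mass w v (a, a') = cres_mass v w (a', a).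
Proof.
rewrite /cres_mass /cres_common /= cres_pcC eq_sym (mulrC (cres_resid w v a)).
by case: eqP => [->|//]; rewrite cres_minC.
Qed.

Lemma nweight_sum1 w : (forall i, 0 < w i) -> \sum_i nweight w i = 1.
Proof.
move=> w0; rewrite -mulr_suml divff// gt_eqF//.
by rewrite big_ord_recl ltr_pwDl// sumr_ge0// => i _; exact: ltW.
Qed.

(** The factor [1 - cres_pc w v] cancels the normalisation of the residual law of [w], and the
    residual law of [v] has mass at most 1. When this factor vanishes, so does the left side. *)
Lemma cres_resid_row_le w v a (P : pred 'I_n.+1) :
  (forall i, 0 <= w i) -> (forall i, 0 <= v i) ->
  \sum_(a' | P a') (1 - cres_pc w v) * (cres_resid w v a * cres_resid v w a') <=
  nweight w a - cres_min w v a.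
Proof.
move=> w0 v0; have pc1 : 0 <= 1 - cres_pc w v by rewrite subr_ge0 cres_pc_le1.
rewrite -mulr_sumr -mulr_sumr mulrA.
apply: (@le_trans _ _ ((1 - cres_pc w v) * cres_resid w v a)).
  rewrite ler_piMr//; first by rewrite mulr_ge0// cres_resid_ge0.
  apply: le_trans _ (cres_resid_sum_le1 w v0); rewrite [leRHS](bigID P)/= lerDl.
  by apply: sumr_ge0 => i _; exact: cres_resid_ge0.
rewrite /cres_resid mulrCA; have [->|p0] := eqVneq (1 - cres_pc w v) 0.
  by rewrite mul0r mulr0 subr_ge0 cres_min_le.
by rewrite divff// mulr1.
Qed.

(** The left side is [nweight w a * (1 - S / S')^+], where [S] and [S'] are the
    sums of [w] and [v]: its dependence on [a] is only through the weight. *)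
Lemma nweight_sub_min_le w v (W : pred 'I_n.+1) a :
  (forall i, 0 < w i) -> (forall i, 0 < v i) ->
  (forall i, W i -> w i = v i) -> W a ->
  nweight w a - cres_min w v a <=
  nweight w a * \sum_(j | ~~ W j) nweight v j.
Proof.
move=> wp vp wv Wa.
have S0 u : (forall i, 0 < u i) -> 0 < \sum_(i < n.+1) u i :> R.
  move=> u0; rewrite big_ord_recl ltr_pwDl// sumr_ge0// => i _; exact: ltW.
have w0 i : 0 <= w i by exact: ltW.
have v0 i : 0 <= v i by exact: ltW.
rewrite /cres_min; have [_|_] := leP (nweight w a) (nweight v a).
  by rewrite subrr mulr_ge0 ?nweight_ge0// sumr_ge0// => j _; exact: nweight_ge0.
rewrite /nweight -wv// -mulr_suml.
have -> : w a / (\sum_j w j) - w a / (\sum_j v j) =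
    w a / (\sum_j w j) * ((\sum_j v j - \sum_j w j) / \sum_j v j).
  have := S0 _ wp; have := S0 _ vp => /lt0r_neq0 ? /lt0r_neq0 ?.
  by field; apply/andP.
apply: ler_wpM2l; first by rewrite divr_ge0// sumr_ge0.
(* The two sums share their part over [W], so their difference is at most the part of the sum of [v]
   outside [W]. *)
rewrite ler_pM2r ?invr_gt0 ?S0// (bigID W xpredT v) (bigID W xpredT w)/=.
have -> : \sum_(i | W i) w i = \sum_(i | W i) v i by exact: eq_bigr.
by rewrite opprD addrACA subrr add0r gerBl sumr_ge0.
Qed.

(** The common draw contributes [cres_min w v a], and the residual draws at most the excess of
    [nweight w a] over it. *)
Lemma cres_row_le w v a :
  (forall i, 0 <= w i) -> (forall i, 0 <= v i) ->
  \sum_a' cres_mass w v (a, a') <= nweight w a.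
Proof.
move=> w0 v0; rewrite /cres_mass /= big_split/= -lerBrDl.
apply: le_trans (cres_resid_row_le a predT w0 v0) _; rewrite lerB//.
rewrite (bigD1 a)//= eqxx mulr1n big1 ?addr0 => [|a' /negbTE]; last first.
  by rewrite eq_sym => ->; rewrite mulr0n mulr0.
rewrite /cres_common; have [->|p0] := eqVneq (cres_pc w v) 0.
  by rewrite mul0r cres_min_ge0.
by rewrite mulrCA divff// mulr1.
Qed.

Lemma cres_side_le w v b (f : 'I_n.+1 -> \bar R) :
  (forall i, 0 <= w i) -> (forall i, 0 <= v i) -> (forall i, 0 <= f i)%E ->
  (\sum_(p : 'I_n.+1 * 'I_n.+1) (cres_mass w v p)%:E * f (side b p) <=
   \sum_a (nweight (side b (w, v)) a)%:E * f a)%E.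
Proof.
move=> w0 v0 f0; have mass0 := cres_mass_ge0 w0 v0.
case: b; rewrite /side /=.
- rewrite -(pair_bigA _ (fun a a' : 'I_n.+1 =>
    (cres_mass w v (a, a'))%:E * f a')%E)/= exchange_big/=.
  apply: lee_sum => a _.
  rewrite -ge0_sume_distrl; last by move=> i _; rewrite lee_fin.
  apply: lee_wpmul2r => //; rewrite sumEFin lee_fin.
  apply: le_trans (cres_row_le a v0 w0).
  by apply: ler_sum => a' _; rewrite cres_massC.
- rewrite -(pair_bigA _ (fun a a' : 'I_n.+1 =>
    (cres_mass w v (a, a'))%:E * f a)%E)/=.
  apply: lee_sum => a _.
  rewrite -ge0_sume_distrl; last by move=> i _; rewrite lee_fin.
  by apply: lee_wpmul2r => //; rewrite sumEFin lee_fin; exact: cres_row_le.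
Qed.

(** For [a] in [W] only residual draws are counted, and their probability is bounded by the weight
    of [a] times a quantity independent of [a]. For the other [a] the whole row is counted, and the
    indicator pays for it. *)
Lemma cres_bad_row_le w v (W : pred 'I_n.+1) a :
  (forall i, 0 < w i) -> (forall i, 0 < v i) ->
  (forall i, W i -> w i = v i) ->
  \sum_(a' | ~~ ((a == a') && W a)) cres_mass w v (a, a') <=
  nweight w a * ((~~ W a)%:R + \sum_(j | ~~ W j) nweight v j).
Proof.
move=> wp vp wv.
have w0 i : 0 <= w i by exact: ltW.
have v0 i : 0 <= v i by exact: ltW.
have [Wa|Wa] := boolP (W a).
  rewrite add0r; apply: le_trans _ (nweight_sub_min_le wp vp wv Wa).
  apply: le_trans _ (cres_resid_row_le a _ w0 v0); apply: ler_sum => a'.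
  by rewrite andbT /cres_mass /= => /negbTE ->; rewrite mulr0n mulr0 add0r.
rewrite /= mulrDr mulr1; apply: (@le_trans _ _ (nweight w a)); last first.
  rewrite lerDl mulr_ge0 ?nweight_ge0// sumr_ge0// => j _.
  exact: nweight_ge0.
rewrite (eq_bigl predT) => [|a']; last by rewrite andbF.
exact: cres_row_le.
Qed.

(** Since [f] only sees the index of the filter followed, the other index is summed out with
    [cres_bad_row_le]. A residual draw is thereby charged to the bad weight of the other filter,
    hence [~~ b]. *)
Lemma cres_bad_side_le w v (W : pred 'I_n.+1) b (f : 'I_n.+1 -> \bar R) :
  (forall i, 0 < w i) -> (forall i, 0 < v i) ->
  (forall i, W i -> w i = v i) -> (forall i, 0 <= f i)%E ->
  (\sum_(p : 'I_n.+1 * 'I_n.+1 | ~~ ((p.1 == p.2) && W p.1))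
     (cres_mass w v p)%:E * f (side b p) <=
   \sum_a (nweight (side b (w, v)) a * ((~~ W a)%:R +
     \sum_(j | ~~ W j) nweight (side (~~ b) (w, v)) j))%:E * f a)%E.
Proof.
move=> wp vp wv f0.
have w0 i : 0 <= w i by exact: ltW.
have v0 i : 0 <= v i by exact: ltW.
have mass0 := cres_mass_ge0 w0 v0.
case: b; rewrite /side /=.
- rewrite big_mkcond -(pair_bigA _ (fun a a' : 'I_n.+1 => if ~~ ((a == a') && W a)
    then (cres_mass w v (a, a'))%:E * f a' else 0)%E)/= exchange_big/=.
  apply: lee_sum => a _; rewrite -big_mkcond/=.
  rewrite -ge0_sume_distrl; last by move=> i _; rewrite lee_fin.
  apply: lee_wpmul2r => //; rewrite sumEFin lee_fin.
  apply: le_trans _ (cres_bad_row_le a vp wp (fun i Wi => esym (wv i Wi))).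
  (* On the diagonal the two indices coincide, so [W] may be tested on either of them. *)
  rewrite (eq_bigl (fun a' => ~~ ((a == a') && W a))) => [|a'].
    by apply: ler_sum => a' _; rewrite cres_massC.
  by rewrite eq_sym; case: eqP => [->|].
- rewrite big_mkcond -(pair_bigA _ (fun a a' : 'I_n.+1 => if ~~ ((a == a') && W a)
    then (cres_mass w v (a, a'))%:E * f a else 0)%E)/=.
  apply: lee_sum => a _; rewrite -big_mkcond/=.
  rewrite -ge0_sume_distrl; last by move=> i _; rewrite lee_fin.
  by apply: lee_wpmul2r => //; rewrite sumEFin lee_fin; exact: cres_bad_row_le.
Qed.

(** The case of constant [f]: as the weights of the first filter sum to 1, the residual term becomes
    the bad weight of the second. *)
Lemma cres_bad_le w v (W : pred 'I_n.+1) :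
  (forall i, 0 < w i) -> (forall i, 0 < v i) ->
  (forall i, W i -> w i = v i) ->
  \sum_(p : 'I_n.+1 * 'I_n.+1 | ~~ ((p.1 == p.2) && W p.1)) cres_mass w v p <=
  \sum_(j | ~~ W j) nweight w j + \sum_(j | ~~ W j) nweight v j.
Proof.
move=> wp vp wv.
have := @cres_bad_side_le w v W false (cst 1%E) wp vp wv (fun=> lee01).
under eq_bigr do rewrite mule1; under [leRHS]eq_bigr do rewrite mule1.
rewrite !sumEFin lee_fin => /le_trans; apply.
rewrite /side /=; under eq_bigr do rewrite mulrDr.
rewrite big_split/= -mulr_suml nweight_sum1// mul1r lerD2r.
rewrite [leRHS]big_mkcond/=; apply: ler_sum => a _.
by case: (W a); rewrite ?mulr0 ?mulr1.
Qed.

End coupled_resampling.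

(** * Measurability of functions on finite spaces *)

Lemma measurable_from_bool d (Z : measurableType d) (f : bool -> Z) :
  measurable_fun setT f.
Proof. by []. Qed.

Lemma measurable_natr_bool d (Y : measurableType d) (R : realType)
    (g : Y -> bool) : measurable_fun setT g ->
  measurable_fun setT (fun y => (g y)%:R : R).
Proof.
move=> mg; apply: (measurableT_comp _ mg (f := fun b : bool => b%:R : R)).
exact: measurable_from_bool.
Qed.

Lemma measurable_indices n (A : set ('I_n.+1 * 'I_n.+1)) : measurable A.
Proof.
rewrite (_ : A = \bigcup_(p in A) ([set p.1] `*` [set p.2])); last first.
  apply/seteqP; split => [p Ap|p [q Aq [/= pq1 pq2]]]; first by exists p.
  by rewrite (surjective_pairing p) pq1 pq2 -surjective_pairing.
apply: fin_bigcup_measurable => [|p _]; last exact: measurableX.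
exact: finite_finset.
Qed.

Lemma measurable_from_indices n d (Z : measurableType d)
    (f : 'I_n.+1 * 'I_n.+1 -> Z) : measurable_fun setT f.
Proof. by move=> _ B mB; exact: measurable_indices. Qed.

(** * Marginals of the coupled mutation *)

Section mutation.
Local Open Scope ereal_scope.
Context d (X : measurableType d) (R : realType).
Variable mu : {sigma_finite_measure set X -> \bar R}.
Variable K : tdensity mu.
Variable C : coupling K.

(** On the diagonal both components are one draw from [K]; off it, the marginals of the coupling are
    the transition laws. So each filter alone moves by [K], whatever the coupling. *)
Lemma giry_int_mutate_side b (z : X * X) (f : X -> \bar R) :
  measurable_fun setT f -> (forall x, 0 <= f x) ->
  giry_int (mutate C z) (f \o side b) =
  \int[mu]_y ((K (side b z) y)%:E * f y).
Proof.
move=> mf f0; have mfb : measurable_fun setT (f \o side b).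
  exact: (measurableT_comp mf (measurable_side b)).
rewrite /mutate; case: ifPn => [/asboolP zz|/asboolPn zz].
  rewrite giry_int_map//; last by move=> x; exact: f0.
  rewrite giry_int_dens//; last by move=> x; exact: f0.
    by rewrite /side /= -zz !if_same; apply: eq_integral => y _; case: b {mfb}.
  by apply: (measurableT_comp mfb); exact: measurable_diag_map.
rewrite -(giry_int_dens (tdensity_ge0 K (side b z))
  (measurable_tdensity_section K (side b z)) (tdensity_int1 K (side b z)))//.
transitivity (giry_int (giry_map (measurable_side b) (C z : giry _ R)) f).
  by rewrite giry_int_map.
apply: eq_measure_integral => A mA _; rewrite /giry_map /pushforward /=.
move: zz; case: z => x x' /= xx'; case: b {mfb}.
  rewrite -/(transition_law K x') -(coupling_snd C xx' mA).
  by congr (C (x, x') _); apply/seteqP; split => [p|p []].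
rewrite -/(transition_law K x) -(coupling_fst C xx' mA).
by congr (C (x, x') _); apply/seteqP; split => [p|p []].
Qed.

Lemma giry_int_mutate_offdiag (mdiag : measurable [set z : X * X | z.1 = z.2])
    (z : X * X) (f : X * X -> \bar R) : z.1 = z.2 ->
  measurable_fun setT f -> (forall p, 0 <= f p) -> (forall x, f (x, x) = 0) ->
  giry_int (mutate C z) f = 0.
Proof.
move=> zz mf f0 fd; rewrite /mutate; case: ifPn => [_|/asboolPn//].
rewrite giry_int_map// /giry_int integral0_eq// => x _; exact: fd.
Qed.

End mutation.

(** * Lineages of one filter pulled back by one time step *)

Section lineage_pullback.
Local Open Scope ereal_scope.
Context d (X : measurableType d) (R : realType).
Variable mu : {sigma_finite_measure set X -> \bar R}.
Variable m : model mu.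
Variable C : forall t, coupling (M m t).
Hypothesis mdiag : measurable [set z : X * X | z.1 = z.2].
Variable n : nat.
Variables s s' : seq X.

Notation indices := ('I_n.+1 * 'I_n.+1)%type.
Notation particle := ((X * X) * indices)%type.
Notation level := (n.+1.-tuple particle).
Notation positions := (n.+1.-tuple X).

Definition pos b (l : level) : positions := [tuple side b (tnth l i).1 | i < n.+1].

Lemma measurable_pos b : measurable_fun setT (pos b).
Proof.
apply/measurable_fun_tnthP => i.
apply: (eq_measurable_fun (fun l : level => side b (tnth l i).1)).
  by move=> l _ /=; rewrite tnth_mktuple.
apply: (measurableT_comp (measurable_side b)).
by apply: measurableT_comp => //; exact: measurable_tnth.
Qed.

Definition weight t (xs : positions) i : R := G m t (tnth xs i).

Lemma omega_pos t l : omega m t l = weight t (pos false l).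
Proof. by apply/funext => i; rewrite /weight tnth_mktuple. Qed.

Lemma omega'_pos t l : omega' m t l = weight t (pos true l).
Proof. by apply/funext => i; rewrite /weight tnth_mktuple. Qed.

Lemma weight_side b t l : side b (omega m t l, omega' m t l) = weight t (pos b l).
Proof. by rewrite /side omega_pos omega'_pos; case: b. Qed.

(** Density at [y] of a new particle of time [t + 1] given the positions of time [t], its parent
    being summed out. *)
Definition offspring_density t (xs : positions) (y : X) : R :=
  (\sum_a nweight (weight t xs) a * M m t.+1 (tnth xs a) y)%R.

(** If [phi i] is the conditional probability, given the positions [xs'] of time
    [t + 1], that some selected lineage goes through particle [i + 1], then
    [pull t phi x j] is the same for particle [j] of time [t], when the
    lineage does not go through the reference [x] of time [t + 1]. *)
Definition pull t (phi : 'I_n -> positions -> \bar R) (x : X) (j : 'I_n.+1)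
    (xs : positions) : \bar R :=
  \sum_(i < n) (nweight (weight t xs) j)%:E *
    iint mu (fupd (fun=> offspring_density t xs) i (M m t.+1 (tnth xs j)))
      (fun v => phi i [tuple of x :: v]).

Lemma weight_ge0 t xs i : (0 <= weight t xs i)%R.
Proof. exact: potential_ge0. Qed.

Lemma nweight_weight_ge0 t xs i : (0 <= nweight (weight t xs) i)%R.
Proof. by apply: nweight_ge0 => j; exact: weight_ge0. Qed.

Lemma offspring_density_ge0 t xs y : (0 <= offspring_density t xs y)%R.
Proof.
by apply: sumr_ge0 => a _; rewrite mulr_ge0 ?nweight_weight_ge0 ?tdensity_ge0.
Qed.

Lemma measurable_nweight_weight t i :
  measurable_fun setT (fun xs : positions => nweight (weight t xs) i).
Proof.
have mw j : measurable_fun setT (fun xs : positions => weight t xs j).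
  apply: (measurableT_comp (measurable_potential (G m t))).
  exact: measurable_tnth.
apply: measurable_funM => //; apply: measurable_fun_inv_ge0.
  by move=> xs; apply: sumr_ge0 => j _; exact: weight_ge0.
exact: measurable_sum.
Qed.

Lemma measurable_transition_at t j : measurable_fun [set: positions * X]
  (fun p => M m t (tnth p.1 j) p.2).
Proof.
have mp : measurable_fun [set: positions * X] (fun p => (tnth p.1 j, p.2)).
  by apply: measurable_fun_pair => //; apply: (measurableT_comp (measurable_tnth j)).
exact: (measurableT_comp (measurable_tdensity (M m t)) mp).
Qed.

Lemma measurable_offspring_density t : measurable_fun [set: positions * X]
  (fun p => offspring_density t p.1 p.2).
Proof.
apply: measurable_sum => a; apply: measurable_funM.
  exact: (measurableT_comp (measurable_nweight_weight t a) measurable_fst).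
exact: measurable_transition_at.
Qed.

Lemma offspring_density_int1 t xs : (forall x, 0 < G m t x)%R ->
  \int[mu]_y (offspring_density t xs y)%:E = 1.
Proof.
move=> G0; under eq_integral do rewrite -sumEFin.
rewrite ge0_integral_sum//.
- under eq_bigr => a _.
    under eq_integral do rewrite EFinM.
    rewrite ge0_integralZl//=; last 3 first.
    + by apply/measurable_EFinP; exact: measurable_tdensity_section.
    + by move=> y _; rewrite lee_fin tdensity_ge0.
    + by rewrite lee_fin nweight_weight_ge0.
    rewrite tdensity_int1 mule1.
    over.
  by rewrite sumEFin nweight_sum1// => i; exact: G0.
- move=> a; apply/measurable_EFinP; apply: measurable_funM => //.
  exact: measurable_tdensity_section.
- by move=> a x _; rewrite lee_fin mulr_ge0 ?nweight_weight_ge0 ?tdensity_ge0.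
Qed.

Section pull.
Variables (t : nat) (phi : 'I_n -> positions -> \bar R) (x : X).
Hypothesis phi0 : forall i xs, 0 <= phi i xs.
Hypothesis mphi : forall i, measurable_fun setT (phi i).

Lemma pull_ge0 j xs : 0 <= pull t phi x j xs.
Proof.
apply: sume_ge0 => i _; rewrite mule_ge0 ?lee_fin ?nweight_weight_ge0//.
apply: iint_ge0 => // k y; apply: fupd_ge0 => [_ z|z].
  exact: offspring_density_ge0.
exact: tdensity_ge0.
Qed.

Lemma measurable_pull j : measurable_fun setT (pull t phi x j).
Proof.
apply: emeasurable_sum => i; apply: emeasurable_funM.
  by apply/measurable_EFinP; exact: measurable_nweight_weight.
apply: (@measurable_iint _ _ _ mu _ positions n
  (fun k xs => fupd (fun=> offspring_density t xs) i (M m t.+1 (tnth xs j)) k)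
  (fun _ v => phi i [tuple of x :: v])) => //.
- move=> k xs y; apply: fupd_ge0 => [_ z|z]; last exact: tdensity_ge0.
  exact: offspring_density_ge0.
- move=> k; rewrite /fupd; case: eqP => _; first exact: measurable_transition_at.
  exact: measurable_offspring_density.
- apply: (measurableT_comp _ measurable_snd
    (f := fun v : n.-tuple X => phi i [tuple of x :: v])).
  exact: measurable_cons_section.
Qed.

(** The offspring density has integral 1, so an average of sums bounded by 1 over independent new
    positions is at most 1. *)
Lemma sum_iint_offspring_le1 xs : (forall y, 0 < G m t y)%R ->
  (forall xs', \sum_(i < n) phi i xs' <= 1) ->
  \sum_(i < n) iint mu (fun=> offspring_density t xs)
    (fun v => phi i [tuple of x :: v]) <= 1.
Proof.
move=> G0 phi1; have md : measurable_fun setT (offspring_density t xs).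
  exact: (measurable_fun_pair2 xs (measurable_offspring_density t)).
have mphi' i : measurable_fun setT (fun v : n.-tuple X => phi i [tuple of x :: v]).
  exact: measurable_cons_section.
rewrite -iint_sum//; last by move=> _ y; exact: offspring_density_ge0.
rewrite -[leRHS](@iint_cst1 _ _ _ mu n (fun=> offspring_density t xs))//.
- apply: le_iint => //; first by move=> _ y; exact: offspring_density_ge0.
  - exact: emeasurable_sum.
  - by move=> v; apply: sume_ge0.
- by move=> _ y; exact: offspring_density_ge0.
- by move=> _; exact: offspring_density_int1.
Qed.

(** Summing over the parent of particle [i] restores the offspring density at coordinate [i], by
    linearity in that factor. *)
Lemma iint_offspring_mixture i xs :
  \sum_a (nweight (weight t xs) a)%:E *
    iint mu (fupd (fun=> offspring_density t xs) i (M m t.+1 (tnth xs a)))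
      (fun v => phi i [tuple of x :: v]) =
  iint mu (fun=> offspring_density t xs) (fun v => phi i [tuple of x :: v]).
Proof.
rewrite -iint_fupd_sum//.
- congr iint; exact: (@fupd_id _ _ _ n (fun=> offspring_density t xs) i).
- by move=> _ y; exact: offspring_density_ge0.
- by move=> _; exact: (measurable_fun_pair2 xs (measurable_offspring_density t)).
- by move=> j; exact: nweight_weight_ge0.
- by move=> j y; exact: tdensity_ge0.
- by move=> j; exact: measurable_tdensity_section.
- exact: measurable_cons_section.
Qed.

(** The normalisation of [phi] survives the pullback, which lets the backward recursion run without
    accumulating constants. Adding the reference parent and summing over all parents reduces to
    [sum_iint_offspring_le1]. *)
Lemma pull_sum_le1 xs : (forall y, 0 < G m t y)%R ->
  (forall xs', \sum_(i < n) phi i xs' <= 1) ->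
  \sum_(j < n) pull t phi x (lift ord0 j) xs <= 1.
Proof.
move=> G0 phi1; apply: le_trans (sum_iint_offspring_le1 xs G0 phi1).
apply: (@le_trans _ _ (\sum_(j < n.+1) pull t phi x j xs)).
  by rewrite big_ord_recl leeDr// pull_ge0.
rewrite /pull exchange_big/=; apply: lee_sum => i _.
by rewrite iint_offspring_mixture.
Qed.

End pull.
End lineage_pullback.

(** Each other term is at least [eps] times the head, so the sum is at least [1 + n * eps] times the
    head. The reference particle being at the head, this is the source of [delta]. *)
Lemma head_le_sum (R : realType) n (f : 'I_n.+1 -> R) (eps : R) :
  0 <= eps -> (forall i, eps * f ord0 <= f i) ->
  f ord0 <= (1 + n%:R * eps)^-1 * \sum_i f i.
Proof.
move=> eps0 ef; have ne0 : 0 < 1 + n%:R * eps by rewrite ltr_wpDr// mulr_ge0.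
rewrite mulrC ler_pdivlMr// big_ord_recl mulrDr mulr1 lerD2l.
apply: (@le_trans _ _ (\sum_(i < n) eps * f ord0)); last exact: ler_sum.
rewrite sumr_const card_ord -mulr_natl le_eqVlt; apply/orP; left; apply/eqP.
ring.
Qed.

(** * One draw: resampling followed by mutation *)

Section step_law.
Local Open Scope ereal_scope.
Context d (X : measurableType d) (R : realType).
Variable mu : {sigma_finite_measure set X -> \bar R}.
Variable m : model mu.
Variable C : forall t, coupling (M m t).
Hypothesis mdiag : measurable [set z : X * X | z.1 = z.2].
Variable n : nat.
Variables s s' : seq X.

Notation indices := ('I_n.+1 * 'I_n.+1)%type.
Notation particle := ((X * X) * indices)%type.
Notation level := (n.+1.-tuple particle).
Notation positions := (n.+1.-tuple X).

Definition parents (l : level) (ab : indices) : X * X :=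
  ((tnth l ab.1).1.1, (tnth l ab.2).1.2).

Lemma side_parents b l ab : side b (parents l ab) = tnth (pos b l) (side b ab).
Proof. by rewrite tnth_mktuple; case: b. Qed.

(** [W] stands for the good particles of the previous time; [good_cons] then identifies [coupled]
    with goodness of a new particle other than the reference. *)
Definition coupled (W : pred 'I_n.+1) (p : particle) : bool :=
  [&& `[< p.1.1 = p.1.2 >], p.2.1 == p.2.2 & W p.2.1].

Lemma measurable_eqX : measurable_fun setT (fun z : X * X => `[< z.1 = z.2 >]).
Proof.
apply: (measurable_fun_bool true); rewrite setTI.
rewrite (_ : _ @^-1` _ = [set z : X * X | z.1 = z.2])//.
by apply/seteqP; split=> z /= /asboolP.
Qed.

Lemma measurable_coupled W : measurable_fun setT (coupled W).
Proof.
apply: measurable_and; first exact: (measurableT_comp measurable_eqX measurable_fst).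
by apply: (measurableT_comp (@measurable_from_indices n _ _
  (fun ab => (ab.1 == ab.2) && W ab.1)) measurable_snd).
Qed.

Definition uncoupled W (p : particle) : R := (~~ coupled W p)%:R.

Lemma measurable_uncoupled W : measurable_fun setT (uncoupled W).
Proof.
by apply: measurable_natr_bool; apply: measurable_neg; exact: measurable_coupled.
Qed.

Lemma uncoupled_ge0 W p : (0 <= uncoupled W p)%R.
Proof. exact: ler0n. Qed.

Section one_draw.
Variables (t : nat) (b : bool) (l : level).
Hypothesis G0 : forall x, (0 < G m t x)%R.

Let xs := pos b l.
Let w i := nweight (weight m t xs) i.

Lemma integral_mixture (c : 'I_n.+1 -> R) (f : X -> \bar R) :
  (forall a, 0 <= c a)%R -> measurable_fun setT f -> (forall x, 0 <= f x) ->
  \int[mu]_y ((\sum_a c a * M m t.+1 (tnth xs a) y)%:E * f y) =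
  \sum_a (c a)%:E * \int[mu]_y ((M m t.+1 (tnth xs a) y)%:E * f y).
Proof.
move=> c0 mf f0.
have mM a : measurable_fun setT (fun y => (M m t.+1 (tnth xs a) y)%:E * f y).
  apply: emeasurable_funM => //; apply/measurable_EFinP.
  exact: measurable_tdensity_section.
have M0 a y : 0 <= (M m t.+1 (tnth xs a) y)%:E * f y.
  by rewrite mule_ge0// lee_fin tdensity_ge0.
under [RHS]eq_bigr => a _ do rewrite -ge0_integralZl ?lee_fin//.
rewrite -ge0_integral_sum//; last 2 first.
- by move=> a; exact: measurable_funeM.
- by move=> a y _; rewrite mule_ge0 ?lee_fin.
apply: eq_integral => y _; rewrite -sumEFin ge0_sume_distrl.
  by apply: eq_bigr => a _; rewrite EFinM muleA.
by move=> a _; rewrite lee_fin mulr_ge0// tdensity_ge0.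
Qed.

Let fM (f : X -> \bar R) a := \int[mu]_y ((M m t.+1 (tnth xs a) y)%:E * f y).

Let fM_ge0 f a : (forall x, 0 <= f x) -> 0 <= fM f a.
Proof.
by move=> f0; apply: integral_ge0 => y _; rewrite mule_ge0// lee_fin tdensity_ge0.
Qed.

(** The domination that [gtprod_draw_le] asks for the draws whose goodness is not tested: one filter
    alone resamples with its own weights and moves by [M]. *)
Lemma resample_draw_le (f : X -> \bar R) :
  measurable_fun setT f -> (forall x, 0 <= f x) ->
  giry_int (resample m t l) (fun ab =>
    giry_int (mutate (C t.+1) (parents l ab)) (f \o side b)) <=
  \int[mu]_y ((offspring_density m t xs y)%:E * f y).
Proof.
move=> mf f0; rewrite integral_mixture//; last by move=> a; exact: nweight_weight_ge0.
rewrite giry_int_flaw; [|exact: measurable_from_indices|]; last first.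
  by move=> ab; apply: integral_ge0 => z _; exact: f0.
under eq_bigr do rewrite giry_int_mutate_side// side_parents.
apply: le_trans (cres_side_le b _ _ (fun a => fM_ge0 a f0)) _.
- by move=> i; exact: potential_ge0.
- by move=> i; exact: potential_ge0.
- by rewrite weight_side.
Qed.

Variables (W : pred 'I_n.+1) (eps : R).
Hypothesis Wl : forall j, W j -> (tnth l j).1.1 = (tnth l j).1.2.
Hypothesis eps0 : (0 <= eps)%R.
Hypothesis GM : forall x x' y,
  (eps * (G m t x * M m t.+1 x y) <= G m t x' * M m t.+1 x' y)%R.

(** Bound on the probability of leaving the good set in one step: the first term pays for hitting
    the reference, the second for a residual draw, charged to the other filter. *)
Definition slip_rate : R := ((1 + n%:R * eps)^-1 +
  \sum_(j | ~~ W j) nweight (weight m t (pos (~~ b) l)) j)%R.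

(** The indicator omits [ord0]: the contribution of the reference is spread over all parents in
    proportion to their weights, through the first term of [slip_rate]. *)
Definition slip_coef a : R := (w a * ((~~ W a && (a != ord0))%:R + slip_rate))%R.

Lemma slip_rate_ge0 : (0 <= slip_rate)%R.
Proof.
rewrite addr_ge0 ?invr_ge0 ?addr_ge0 ?mulr_ge0// sumr_ge0// => j _.
exact: nweight_weight_ge0.
Qed.

Lemma slip_coef_ge0 a : (0 <= slip_coef a)%R.
Proof. by rewrite mulr_ge0 ?nweight_weight_ge0// addr_ge0// slip_rate_ge0. Qed.

(** By Bayes' rule, the ratio of the two densities is the probability that a particle found at [y]
    descends from the reference. The bound is uniform in [y], so it is insensitive to the later
    course of the lineage. *)
Lemma reference_density_le y :
  (w ord0 * M m t.+1 (tnth xs ord0) y <=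
   (1 + n%:R * eps)^-1 * offspring_density m t xs y)%R.
Proof.
apply: (@head_le_sum _ _ (fun a => w a * M m t.+1 (tnth xs a) y)%R) => // i.
rewrite /w /nweight; set S := (\sum_j _)%R.
rewrite !(mulrAC _ S^-1%R) mulrA ler_wpM2r//; last exact: GM.
by rewrite invr_ge0 sumr_ge0// => j _; exact: weight_ge0.
Qed.

(** A common index in [W] gives equal parents, hence a coupled particle, and contributes nothing.
    The other pairs are bounded by [cres_bad_side_le], after which the reference term is
    redistributed. *)
Lemma resample_bad_le (f : X -> \bar R) :
  measurable_fun setT f -> (forall x, 0 <= f x) ->
  giry_int (resample m t l) (fun ab => giry_int (mutate (C t.+1) (parents l ab))
    (fun z => (uncoupled W (z, ab))%:E * f (side b z))) <=
  \int[mu]_y ((\sum_a slip_coef a * M m t.+1 (tnth xs a) y)%:E * f y).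
Proof.
move=> mf f0; rewrite integral_mixture//; last exact: slip_coef_ge0.
have mfb : measurable_fun setT (f \o side b).
  exact: (measurableT_comp mf (measurable_side b)).
have mun ab : measurable_fun setT
    (fun z => (uncoupled W (z, ab))%:E * f (side b z)).
  apply: emeasurable_funM => //; apply/measurable_EFinP.
  exact: (measurable_fun_pair1 ab (measurable_uncoupled W)).
have un0 ab z : 0 <= (uncoupled W (z, ab))%:E * f (side b z).
  by rewrite mule_ge0// lee_fin uncoupled_ge0.
rewrite giry_int_flaw; [|exact: measurable_from_indices|]; last first.
  by move=> ab; apply: integral_ge0 => z _; exact: un0.
have om0 i : (0 < omega m t l i)%R by exact: G0.
have om'0 i : (0 < omega' m t l i)%R by exact: G0.
have omW i : W i -> omega m t l i = omega' m t l i.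
  by move=> Wi; rewrite /omega /omega' Wl.
apply: (@le_trans _ _ (\sum_(p : indices | ~~ ((p.1 == p.2) && W p.1))
    (cres_mass (omega m t l) (omega' m t l) p)%:E * fM f (side b p))).
  rewrite [leRHS]big_mkcond; apply: lee_sum => -[a a'] _ /=.
  case: ifPn => [_|].
    rewrite lee_wpmul2l//.
      by rewrite lee_fin cres_mass_ge0// => i; exact: ltW.
    rewrite /fM -side_parents -(giry_int_mutate_side (C t.+1))//.
    apply: le_giry_int => // z.
    by rewrite -[leRHS]mul1e lee_wpmul2r// lee_fin /uncoupled; case: coupled.
  rewrite negbK => /andP[/eqP <- Wa].
  rewrite giry_int_mutate_offdiag ?mule0//=; first exact: Wl.
  by move=> x; rewrite /uncoupled /coupled/= eqxx Wa asboolT// mul0e.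
apply: le_trans (cres_bad_side_le b om0 om'0 omW (fun a => fM_ge0 a f0)) _.
rewrite !weight_side -/xs.
set u := (\sum_(j | ~~ W j) nweight (weight m t (pos (~~ b) l)) j)%R.
set dl := ((1 + n%:R * eps)^-1)%R.
have u0 : (0 <= u)%R by apply: sumr_ge0 => j _; exact: nweight_weight_ge0.
have dl0 : (0 <= dl)%R by rewrite invr_ge0 addr_ge0// mulr_ge0.
have w0 a : (0 <= w a)%R by exact: nweight_weight_ge0.
(* The reference term is compared pointwise in [y], before integration against [f]. *)
have ref : (w ord0)%:E * fM f ord0 <= \sum_a (dl * w a)%:E * fM f a.
  rewrite -integral_mixture//; last by move=> a; rewrite mulr_ge0.
  have mM0 : measurable_fun setT (M m t.+1 (tnth xs ord0)).
    exact: measurable_tdensity_section.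
  have mo : measurable_fun setT (offspring_density m t xs).
    exact: (measurable_fun_pair2 xs (measurable_offspring_density m t)).
  rewrite /fM -ge0_integralZl//; last 3 first.
  - by apply: emeasurable_funM => //; exact/measurable_EFinP.
  - by move=> y _; rewrite mule_ge0// lee_fin tdensity_ge0.
  - by rewrite lee_fin.
  apply: ge0_le_integral => //.
  - by move=> y _; rewrite !mule_ge0// lee_fin// tdensity_ge0.
  - apply: emeasurable_funM => //.
    by apply: emeasurable_funM => //; exact/measurable_EFinP.
  - apply: emeasurable_funM => //; apply/measurable_EFinP.
    apply: measurable_sum => a; apply: measurable_funM => //.
    exact: measurable_tdensity_section.
  - move=> y _; rewrite muleA lee_wpmul2r// -EFinM lee_fin.
    under eq_bigr do rewrite -mulrA.
    by rewrite -mulr_sumr; exact: reference_density_le.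
have coefE a : (slip_coef a)%:E * fM f a =
    (w a * ((~~ W a && (a != ord0))%:R + u))%:E * fM f a +
    (dl * w a)%:E * fM f a.
  have wu0 : (0 <= w a * ((~~ W a && (a != ord0))%:R + u))%R.
    by rewrite mulr_ge0// addr_ge0.
  have wd0 : (0 <= dl * w a)%R by rewrite mulr_ge0.
  rewrite -ge0_muleDl ?lee_fin// -EFinD.
  by congr (_%:E * _); rewrite /slip_coef /slip_rate -/u -/dl; ring.
under [leRHS]eq_bigr do rewrite -/(fM _ _) coefE.
rewrite big_split/=.
apply: (@le_trans _ _ (\sum_a (w a * ((~~ W a && (a != ord0))%:R + u))%:E *
    fM f a + (w ord0)%:E * fM f ord0)); last by rewrite leeD2l.
(* At [ord0] the indicator of [~~ W ord0] is at most 1, which the term set aside covers; the other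
   terms agree. *)
rewrite (bigD1 ord0)//= [X in _ <= X + _](bigD1 ord0)//= addeAC.
apply: leeD; last first.
  rewrite le_eqVlt; apply/orP; left; apply/eqP; apply: eq_bigr => a a0.
  by rewrite a0 andbT.
have wu0 : (0 <= w ord0 * ((~~ W ord0 && (ord0 != ord0 :> 'I_n.+1))%:R + u))%R.
  by rewrite mulr_ge0// addr_ge0.
rewrite -ge0_muleDl ?lee_fin// -EFinD.
rewrite lee_wpmul2r ?fM_ge0// lee_fin -/(w ord0) -[X in (_ <= _ + X)%R]mulr1 -mulrDr.
by rewrite ler_wpM2l// andbF add0r addrC lerD2l; case: (W ord0).
Qed.

End one_draw.
End step_law.

(** * One time step of the whole particle system *)

Section step_bound.
Local Open Scope ereal_scope.
Context d (X : measurableType d) (R : realType).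
Variable mu : {sigma_finite_measure set X -> \bar R}.
Variable m : model mu.
Variable C : forall t, coupling (M m t).
Hypothesis mdiag : measurable [set z : X * X | z.1 = z.2].
Variable n : nat.
Variables s s' : seq X.

Notation indices := ('I_n.+1 * 'I_n.+1)%type.
Notation particle := ((X * X) * indices)%type.
Notation level := (n.+1.-tuple particle).
Notation positions := (n.+1.-tuple X).

Lemma giry_int_step t (l : level) (F : level -> \bar R) :
  measurable_fun setT F -> (forall l', 0 <= F l') ->
  giry_int (step C mdiag s s' t l) F =
  giry_int (resamples m t l) (fun ids =>
    giry_int (mutates C t.+1 (l, ids)) (fun zs =>
      F (next_level s s' t.+1 ((l, ids), zs)))).
Proof.
move=> mF F0; rewrite /step giry_int_map//.
have mFn := measurableT_comp mF (measurable_next_level (n := n) s s' t.+1).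
rewrite giry_int_bind_keep//; last by move=> p; exact: F0.
rewrite giry_int_keep//.
- apply: (@measurable_giry_int_param _ _ _ _ _ (mutates C t.+1)
    (fun p => F (next_level s s' t.+1 p))) => //.
  exact: measurable_mutates.
- by move=> p; apply: integral_ge0 => zs _; exact: F0.
Qed.

Lemma pos_next_level b t (l : level) ids zs :
  pos b (next_level s s' t ((l, ids), zs)) =
  [tuple of side b (refs n s s' t).1 :: map_tuple (side b) zs].
Proof.
apply: eq_from_tnth => i; rewrite tnth_mktuple.
have [j ->|->] := unliftP ord0 i; last by [].
by rewrite /next_level !tnthS tnth_mktuple tnth_map.
Qed.

Variables (t : nat) (b : bool) (l : level) (W : pred 'I_n.+1) (eps : R).
Hypothesis G0 : forall x, (0 < G m t x)%R.
Hypothesis Wl : forall j, W j -> (tnth l j).1.1 = (tnth l j).1.2.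
Hypothesis eps0 : (0 <= eps)%R.
Hypothesis GM : forall x x' y,
  (eps * (G m t x * M m t.+1 x y) <= G m t x' * M m t.+1 x' y)%R.
Variable phi : 'I_n -> positions -> \bar R.
Hypothesis phi0 : forall i xs, 0 <= phi i xs.
Hypothesis mphi : forall i, measurable_fun setT (phi i).
Hypothesis phi1 : forall xs, \sum_(i < n) phi i xs <= 1.

Let xs := pos b l.
Let xr := side b (refs n s s' t.+1).1.
Let g i (v : n.-tuple X) := phi i [tuple of xr :: v].

Let mg i : measurable_fun setT (g i).
Proof. exact: measurable_cons_section. Qed.

Let g0 i v : 0 <= g i v. Proof. exact: phi0. Qed.

Let od_ge0 (k : 'I_n) y : (0 <= (fun _ : 'I_n => offspring_density m t xs) k y)%R.
Proof. exact: offspring_density_ge0. Qed.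

Let mod_ : measurable_fun setT (offspring_density m t xs).
Proof. exact: (measurable_fun_pair2 xs (measurable_offspring_density m t)). Qed.

Let measurable_bad i : measurable_fun setT (fun l' : level =>
  (uncoupled R W (tnth l' (lift ord0 i)))%:E * phi i (pos b l')).
Proof.
apply: emeasurable_funM; last first.
  exact: (measurableT_comp (mphi i) (measurable_pos b)).
apply/measurable_EFinP.
have mt : measurable_fun setT (fun l' : level => tnth l' (lift ord0 i)).
  exact: measurable_tnth.
exact: (measurableT_comp (@measurable_uncoupled _ _ R mdiag _ W) mt).
Qed.

(** Only draw [i] carries an indicator, and [phi i] depends on one filter. Hence the density changes
    at coordinate [i] alone, where [resample_bad_le] applies; the other coordinates keep the
    offspring density. *)
Lemma step_bad_one_le i :
  giry_int (step C mdiag s s' t l) (fun l' =>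
    (uncoupled R W (tnth l' (lift ord0 i)))%:E * phi i (pos b l')) <=
  iint mu (fupd (fun=> offspring_density m t xs) i
    (fun y => \sum_a slip_coef m t b l W eps a * M m t.+1 (tnth xs a) y)%R) (g i).
Proof.
rewrite giry_int_step; last 2 first.
- exact: measurable_bad.
- by move=> l'; rewrite mule_ge0 ?lee_fin ?uncoupled_ge0.
pose K (ab : indices) := mutate (C t.+1) (parents l ab).
pose B (k : 'I_n) (p : indices * (X * X)) :=
  if k == i then uncoupled R W (p.2, p.1) else 1%R.
have -> : giry_int (resamples m t l) (fun ids =>
    giry_int (mutates C t.+1 (l, ids)) (fun zs =>
      (uncoupled R W (tnth (next_level s s' t.+1 (l, ids, zs)) (lift ord0 i)))%:E *
      phi i (pos b (next_level s s' t.+1 (l, ids, zs))))) =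
    giry_int (gtprod [tuple resample m t l | i < n]) (fun ids =>
      giry_int (gtprod (map_tuple K ids)) (weighted_draw (side b) B (g i) ids)).
  apply: eq_integral => ids _; rewrite /mutates.
  rewrite (_ : mktuple _ = map_tuple K ids); last first.
    by apply: eq_from_tnth => k; rewrite tnth_mktuple tnth_map.
  apply: eq_integral => zs _; rewrite pos_next_level /weighted_draw.
  congr (_%:E * _); rewrite (bigD1 i)//= big1 ?mulr1 => [|k /negbTE]; last first.
    by rewrite /B => ->.
  by rewrite /B eqxx /next_level tnthS tnth_mktuple.
apply: gtprod_draw_le => //.
- exact: measurable_from_indices.
- exact: measurable_side.
- by move=> k p; rewrite /B; case: eqP => // _; exact: uncoupled_ge0.
- move=> k; rewrite /B; case: eqP => _; last exact: measurable_cst.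
  have msw : measurable_fun [set: indices * (X * X)] (fun p => (p.2, p.1)).
    exact: measurable_fun_pair.
  exact: (measurableT_comp (@measurable_uncoupled _ _ R mdiag _ W) msw).
- apply: fupd_ge0 => // y; apply: sumr_ge0 => a _.
  by rewrite mulr_ge0 ?slip_coef_ge0 ?tdensity_ge0.
- apply: measurable_fupd => //; apply: measurable_sum => a.
  by apply: measurable_funM => //; exact: measurable_tdensity_section.
move=> k f mf f0; rewrite tnth_mktuple /B /fupd; case: eqP => _ /=.
  exact: resample_bad_le.
apply: le_trans _ (resample_draw_le C t b l mf f0).
rewrite le_eqVlt; apply/orP; left; apply/eqP.
by apply: eq_integral => ab _; apply: eq_integral => z _; rewrite mul1e.
Qed.

(** Linearity at coordinate [i] splits [slip_coef]. Its indicator part, summed over [i], is [pull]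
    at the bad parents other than the reference: the lineage was already bad. In the [slip_rate]
    part, summing over parents restores the offspring density, and the total of [phi] is at most
    1. *)
Lemma step_bad_le :
  giry_int (step C mdiag s s' t l) (fun l' => \sum_(i < n)
    (uncoupled R W (tnth l' (lift ord0 i)))%:E * phi i (pos b l')) <=
  \sum_(i < n) (~~ W (lift ord0 i))%:R%:E * pull m t phi xr (lift ord0 i) xs +
  (slip_rate m t b l W eps)%:E.
Proof.
rewrite /giry_int ge0_integral_sum//; last first.
  by move=> i l' _; rewrite mule_ge0 ?lee_fin ?uncoupled_ge0.
apply: (le_trans (lee_sum _ (fun i _ => step_bad_one_le i))).
have c0 := slip_coef_ge0 m t b l W eps0.
have r0 : (0 <= slip_rate m t b l W eps)%R by exact: slip_rate_ge0.
pose I i a := iint mu (fupd (fun=> offspring_density m t xs) i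
  (M m t.+1 (tnth xs a))) (g i).
have I0 i a : 0 <= I i a.
  apply: iint_ge0 => // k y; apply: fupd_ge0 => // z; exact: tdensity_ge0.
pose w a := nweight (weight m t xs) a.
have w0 a : (0 <= w a)%R by exact: nweight_weight_ge0.
under eq_bigr => i _.
  rewrite iint_fupd_sum//; [|by move=> a y; exact: tdensity_ge0|
    by move=> a; exact: measurable_tdensity_section].
  rewrite (eq_bigr (fun a => (~~ W a && (a != ord0))%:R%:E * ((w a)%:E * I i a) +
    (slip_rate m t b l W eps)%:E * ((w a)%:E * I i a))); last first.
    move=> a _; rewrite -ge0_muleDl ?lee_fin// -EFinD muleA -EFinM.
    by congr (_%:E * _); rewrite mulrC.
  rewrite big_split/= -[X in _ + X]ge0_sume_distrr; last first.
    by move=> a _; rewrite mule_ge0 ?lee_fin.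
  rewrite iint_offspring_mixture//.
  over.
rewrite big_split/= leeD//.
  rewrite exchange_big/= big_ord_recl/=.
  rewrite big1 ?add0e => [|i _]; last by rewrite andbF mul0e.
  apply: lee_sum => j _; rewrite andbT -ge0_sume_distrr//.
  by move=> i _; rewrite mule_ge0 ?lee_fin.
rewrite -ge0_sume_distrr; last by move=> i _; exact: iint_ge0.
rewrite -[leRHS]mule1 lee_wpmul2l ?lee_fin//.
exact: sum_iint_offspring_le1.
Qed.

End step_bound.

(** * Induction on time along the particle history *)

Section history_bound.
Local Open Scope ereal_scope.
Context d (X : measurableType d) (R : realType).
Variable mu : {sigma_finite_measure set X -> \bar R}.
Variable m : model mu.
Variable C : forall t, coupling (M m t).
Hypothesis mdiag : measurable [set z : X * X | z.1 = z.2].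
Variable n : nat.
Variables s s' : seq X.

Notation indices := ('I_n.+1 * 'I_n.+1)%type.
Notation particle := ((X * X) * indices)%type.
Notation level := (n.+1.-tuple particle).
Notation positions := (n.+1.-tuple X).

(** Both trajectories traced back from particle [i] use the same indices, avoid
    the reference particle, and occupy the same positions. *)
Fixpoint good t : t.-tuple level -> 'I_n.+1 -> bool :=
  match t with
  | 0 => fun _ _ => false
  | t'.+1 => fun h i => let p := tnth (thead h) i in
      [&& i != ord0, `[< p.1.1 = p.1.2 >] & (t' == 0)%N ||
        ((p.2.1 == p.2.2) && good [tuple of behead h] p.2.1)]
  end.

Lemma good0 t (h : t.-tuple level) : good h ord0 = false.
Proof. by case: t h => //= t h; rewrite eqxx. Qed.

Lemma good_position t (h : t.-tuple level) j : good h j ->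
  (tnth (last_level h) j).1.1 = (tnth (last_level h) j).1.2.
Proof.
case: t h => //= t h /and3P[_ /asboolP + _].
by rewrite /last_level -nth0 -[nth _ _ _](tnth_nth point h ord0).
Qed.

Lemma good_cons t (h : t.+1.-tuple level) (l : level) i :
  good [tuple of l :: h] (lift ord0 i) = coupled (good h) (tnth l (lift ord0 i)).
Proof.
have bh : [tuple of behead [tuple of l :: h]] = h by exact: val_inj.
by rewrite -[LHS]/([&& _, _ & _]) theadE bh.
Qed.

Lemma measurable_good t i : measurable_fun setT (fun h : t.-tuple level => good h i).
Proof.
elim: t i => [|t IH] i /=; first exact: measurable_cst.
have mp : measurable_fun setT (fun h : t.+1.-tuple level => tnth (thead h) i).
  apply: (measurableT_comp (measurable_tnth i)).
  exact: (measurable_tnth ord0).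
apply: measurable_and; first exact: measurable_cst.
apply: measurable_and.
  exact: (measurableT_comp (measurableT_comp (measurable_eqX mdiag) measurable_fst) mp).
apply: measurable_or; first exact: measurable_cst.
apply: measurable_and.
  exact: (measurableT_comp (measurableT_comp (@measurable_from_indices n _ _
    (fun ab => ab.1 == ab.2)) measurable_snd) mp).
(* The ancestor index depends on [h], so goodness at that index is read as an entry of the tuple of
   all its values. *)
apply: (eq_measurable_fun (fun h : t.+1.-tuple level =>
    tnth [tuple good [tuple of behead h] a | a < n.+1] (tnth (thead h) i).2.1)).
  by move=> h _; rewrite tnth_mktuple.
apply: measurable_fun_tnth.
  apply/measurable_fun_tnthP => a.
  apply: (eq_measurable_fun (fun h : t.+1.-tuple level => good [tuple of behead h] a)).
    by move=> h _ /=; rewrite tnth_mktuple.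
  exact: (measurableT_comp (IH a) (@measurable_behead _ _ t)).
exact: (measurableT_comp (measurableT_comp measurable_fst measurable_snd) mp).
Qed.

Lemma lineage_good t (h : t.-tuple level) i k : good h i ->
  (tnth (lineage h (i, i)) k).1 = (tnth (lineage h (i, i)) k).2.
Proof.
elim: t h i k => [|t IH] h i k //= /and3P[_ /asboolP eqx gI].
have [j ->|->] := unliftP ord0 k; last by [].
rewrite tnthS; case: t IH h j gI {k} eqx => [|t] IH h j gI eqx; first by case: j.
by move: gI => /= /andP[/eqP <- gI]; exact: IH.
Qed.

Definition miss t (h : t.-tuple level) j : R := (~~ good h j)%:R.

Lemma miss_ge0 t (h : t.-tuple level) j : (0 <= miss h j)%R.
Proof. exact: ler0n. Qed.

Lemma measurable_miss t j : measurable_fun setT (fun h : t.-tuple level => miss h j).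
Proof.
by apply: measurable_natr_bool; apply: measurable_neg; exact: measurable_good.
Qed.

(** For [phi] as in [pull], the conditional probability that the lineage is at a bad particle of
    time [t] other than the reference. Hitting the reference is charged separately. *)
Definition bad_mass t b (phi : 'I_n -> positions -> \bar R) (h : t.-tuple level) :=
  \sum_(i < n) (miss h (lift ord0 i))%:E * phi i (pos b (last_level h)).

Lemma bad_mass_ge0 t b phi (h : t.-tuple level) :
  (forall i xs, 0 <= phi i xs) -> 0 <= bad_mass b phi h.
Proof. by move=> phi0; apply: sume_ge0 => i _; rewrite mule_ge0// lee_fin miss_ge0. Qed.

Lemma measurable_last_pos t b :
  measurable_fun setT (fun h : t.-tuple level => pos b (last_level h)).
Proof. exact: (measurableT_comp (measurable_pos b) (@measurable_last_level _ X n t)). Qed.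

Lemma measurable_bad_mass t b phi : (forall i, measurable_fun setT (phi i)) ->
  measurable_fun setT (@bad_mass t b phi).
Proof.
move=> mphi; apply: emeasurable_sum => i; apply: emeasurable_funM.
  by apply/measurable_EFinP; exact: measurable_miss.
exact: (measurableT_comp (mphi i) (@measurable_last_pos t b)).
Qed.

(** Its mean under the history is [u_t] in the outline above. Unlike in [bad_mass], the reference is
    included; it is always bad by [good0]. *)
Definition slip b t (h : t.-tuple level) : R :=
  (\sum_j miss h j * nweight (weight m t (pos b (last_level h))) j)%R.

Lemma slip_ge0 b t (h : t.-tuple level) : (0 <= slip b h)%R.
Proof. by apply: sumr_ge0 => j _; rewrite mulr_ge0 ?miss_ge0 ?nweight_weight_ge0. Qed.

Lemma measurable_slip b t : measurable_fun setT (@slip b t).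
Proof.
apply: measurable_sum => j; apply: measurable_funM; first exact: measurable_miss.
exact: (measurableT_comp (measurable_nweight_weight m t j) (@measurable_last_pos t b)).
Qed.

Lemma slipE b t (h : t.-tuple level) : slip b h =
  (\sum_(j | ~~ good h j) nweight (weight m t (pos b (last_level h))) j)%R.
Proof.
rewrite [RHS]big_mkcond; apply: eq_bigr => j _; rewrite /miss.
by case: good; rewrite ?mul0r ?mul1r.
Qed.

Lemma giry_int_historyS t (F : t.+1.-tuple level -> \bar R) :
  measurable_fun setT F -> (forall h, 0 <= F h) ->
  giry_int (history C mdiag n s s' t.+1) F =
  giry_int (history C mdiag n s s' t) (fun h =>
    giry_int (new_level C mdiag s s' h) (fun l => F [tuple of l :: h])).
Proof.
move=> mF F0 /=; rewrite giry_int_map// giry_int_bind_keep//.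
- have mc : measurable_fun [set: t.-tuple level * level]
      (fun p => [tuple of p.2 :: p.1]) by exact: measurable_cons.
  exact: (measurableT_comp mF mc).
- by move=> p; exact: F0.
Qed.

Variables (T : nat) (eps : R).
Hypothesis eps0 : (0 <= eps)%R.
Hypothesis G0 : forall t x, (1 <= t <= T)%N -> (0 < G m t x)%R.
Hypothesis GG : forall t x x', (1 <= t <= T)%N -> (eps * G m t x <= G m t x')%R.
Hypothesis GM : forall t x x' y, (1 <= t < T)%N ->
  (eps * (G m t x * M m t.+1 x y) <= G m t x' * M m t.+1 x' y)%R.

Let dl : R := ((1 + n%:R * eps)^-1)%R.

Let dl0 : (0 <= dl)%R. Proof. by rewrite invr_ge0 addr_ge0// mulr_ge0. Qed.

(** A draw by the weights alone involves no later position, so only potentials are compared, through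
    [GG]. *)
Lemma reference_weight_le t (xs : positions) : (1 <= t <= T)%N ->
  (nweight (weight m t xs) ord0 <= dl)%R.
Proof.
move=> tT; have w1 := nweight_sum1 (fun i => G0 (tnth xs i) tT).
rewrite -[leRHS]mulr1 -w1; apply: head_le_sum => // i.
rewrite /nweight mulrA ler_wpM2r//; last exact: GG.
by rewrite invr_ge0 sumr_ge0// => j _; exact: weight_ge0.
Qed.

(** The bound on [bad_mass] is a hypothesis so that [history_bad_le] can use this lemma within its
    own induction. The draw hits the reference with probability at most [dl]; the remaining weights
    form an admissible [phi]. *)
Lemma history_slip_le t b : (1 <= t <= T)%N ->
  (forall phi, (forall i xs, 0 <= phi i xs) ->
    (forall i, measurable_fun setT (phi i)) ->
    (forall xs, \sum_(i < n) phi i xs <= 1) ->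
    giry_int (history C mdiag n s s' t) (bad_mass b phi) <=
      ((2 ^+ t - 2) * dl)%:E) ->
  giry_int (history C mdiag n s s' t) (EFin \o slip b (t := t)) <=
    ((2 ^+ t - 1) * dl)%:E.
Proof.
move=> tT IH; pose phi (i : 'I_n) (xs : positions) : \bar R :=
  (nweight (weight m t xs) (lift ord0 i))%:E.
have phi0 i xs : 0 <= phi i xs by rewrite lee_fin nweight_weight_ge0.
have mphi i : measurable_fun setT (phi i).
  by apply/measurable_EFinP; exact: measurable_nweight_weight.
apply: (@le_trans _ _ (giry_int (history C mdiag n s s' t)
    (fun h => dl%:E + bad_mass b phi h))).
  apply: le_giry_int.
  - by apply/measurable_EFinP; exact: measurable_slip.
  - by apply: emeasurable_funD => //; exact: measurable_bad_mass.
  - by move=> h; rewrite lee_fin slip_ge0.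
  - move=> h; rewrite /= /slip big_ord_recl EFinD leeD//.
      rewrite lee_fin /miss good0 mul1r; exact: reference_weight_le.
    by rewrite -sumEFin.
rewrite /giry_int ge0_integralD//; last 2 first.
- by move=> h _; exact: bad_mass_ge0.
- exact: measurable_bad_mass.
rewrite (_ : (2 ^+ t - 1) * dl = dl + (2 ^+ t - 2) * dl)%R; last by ring.
rewrite EFinD leeD//.
  by apply: (@giry_int_cst_le _ _ R) => //= h; rewrite lee_fin.
apply: IH => // xs; rewrite /phi sumEFin lee_fin.
rewrite -(nweight_sum1 (fun i => G0 (tnth xs i) tT)) big_ord_recl lerDr.
exact: nweight_weight_ge0.
Qed.

(** The induction varies [phi], since a step replaces it by its pullback, and [b], since a residual
    draw is charged to the other filter. Writing [a_t] for the bound, the step gives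
    [a_(t+1) = a_t + dl + (a_t + dl)] with [a_1 = 0], whence [a_t = (2^t - 2) dl]. *)
Lemma history_bad_le t : (t < T)%N -> forall b phi,
  (forall i xs, 0 <= phi i xs) ->
  (forall i, measurable_fun setT (phi i)) ->
  (forall xs, \sum_(i < n) phi i xs <= 1) ->
  giry_int (history C mdiag n s s' t.+1) (bad_mass b phi) <=
    ((2 ^+ t.+1 - 2) * dl)%:E.
Proof.
elim: t => [|t IH] tT b phi phi0 mphi phi1.
  rewrite giry_int_historyS; [|exact: measurable_bad_mass|
    by move=> h; exact: bad_mass_ge0].
  (* At time 1 the particles other than the reference are shared by the two filters, hence good. *)
  rewrite expr1 subrr mul0r /giry_int integral0_eq// => h _ /=.
  rewrite -[LHS]/(giry_int (init m n s s') _) /init giry_int_map//; last 2 first.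
  - have mc : measurable_fun setT (fun l : level => [tuple of l :: h]).
      exact: measurable_cons.
    exact: (measurableT_comp (measurable_bad_mass b mphi) mc).
  - by move=> l; exact: bad_mass_ge0.
  rewrite /giry_int integral0_eq// => v _ /=; rewrite /bad_mass big1// => i _.
  by rewrite /miss /= theadE /first_level tnthS tnth_mktuple/= asboolT// mul0e.
have tT' : (t.+1 < T)%N by [].
have t1T : (1 <= t.+1 < T)%N by [].
have t1T' : (1 <= t.+1 <= T)%N by exact: ltnW.
rewrite giry_int_historyS; [|exact: measurable_bad_mass|
  by move=> h; exact: bad_mass_ge0].
pose xr := side b (refs n s s' t.+2).1.
pose phi' i := pull m t.+1 phi xr (lift ord0 i).
have phi'0 i xs : 0 <= phi' i xs by exact: pull_ge0.
have mphi' i : measurable_fun setT (phi' i) by exact: measurable_pull.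
have phi'1 xs : \sum_(i < n) phi' i xs <= 1.
  by apply: pull_sum_le1 => // y; exact: G0.
have msl : measurable_fun setT (EFin \o @slip (~~ b) t.+1).
  by apply/measurable_EFinP; exact: measurable_slip.
(* The three terms: the parent was already bad, the parent is the reference, or a residual draw
   occurred. *)
apply: (@le_trans _ _ (giry_int (history C mdiag n s s' t.+1)
    (fun h => bad_mass b phi' h + (dl%:E + (slip (~~ b) h)%:E)))).
  apply: le_giry_int.
  - apply: (@measurable_giry_int_param _ _ _ _ R (new_level C mdiag s s' (t := t.+1))
      (fun p => bad_mass b phi [tuple of p.2 :: p.1])).
    + exact: measurable_new_level.
    + have mc : measurable_fun [set: t.+1.-tuple level * level]
          (fun p => [tuple of p.2 :: p.1]) by exact: measurable_cons.
      exact: (measurableT_comp (measurable_bad_mass b mphi) mc).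
    + by move=> p; exact: bad_mass_ge0.
  - apply: emeasurable_funD; first exact: measurable_bad_mass.
    by apply: emeasurable_funD.
  - by move=> h; apply: integral_ge0 => l _; exact: bad_mass_ge0.
  - move=> h /=.
    have -> : (fun l => bad_mass b phi [tuple of l :: h]) = (fun l => \sum_(i < n)
        (uncoupled R (good h) (tnth l (lift ord0 i)))%:E * phi i (pos b l)).
      apply/funext => l; apply: eq_bigr => i _.
      by rewrite /miss good_cons.
    rewrite -EFinD slipE.
    apply: (@step_bad_le _ _ _ _ _ _ mdiag n s s' t.+1 b (last_level h)
      (good h) eps) => //.
    + by move=> x; exact: G0.
    + by move=> j; exact: good_position.
    + by move=> x x' y; exact: GM.
rewrite /giry_int ge0_integralD//; last 4 first.
- by move=> h _; exact: bad_mass_ge0.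
- exact: measurable_bad_mass.
- by move=> h _; rewrite -EFinD lee_fin addr_ge0// slip_ge0.
- exact: emeasurable_funD.
rewrite ge0_integralD//; last by move=> h _; rewrite lee_fin slip_ge0.
rewrite (_ : (2 ^+ t.+2 - 2) * dl =
  (2 ^+ t.+1 - 2) * dl + (dl + (2 ^+ t.+1 - 1) * dl))%R; last first.
  by rewrite [in LHS]exprS; ring.
rewrite !EFinD !leeD//.
- by apply: IH => //; exact: ltnW.
- by apply: (@giry_int_cst_le _ _ R) => //= h; rewrite lee_fin.
- by apply: history_slip_le => //; apply: IH; exact: ltnW.
Qed.

Lemma history_slip_total_le t b : (1 <= t <= T)%N ->
  giry_int (history C mdiag n s s' t) (EFin \o slip b (t := t)) <=
    ((2 ^+ t - 1) * dl)%:E.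
Proof.
move=> tT; apply: history_slip_le => // phi; case: t tT => // t tT.
exact: history_bad_le.
Qed.

End history_bound.

(** * Comparison of weights under strong mixing *)

Lemma bigmin_seq_le (R : realType) (I : eqType) (r : seq I) (F : I -> R) x0 i :
  i \in r -> \big[Num.min/x0]_(j <- r) F j <= F i.
Proof.
elim: r => // j r IH; rewrite inE big_cons ge_min => /orP[/eqP ->|/IH ->].
  by rewrite lexx.
by rewrite orbT.
Qed.

Section mixing.
Context d (X : measurableType d) (R : realType).
Variable mu : {measure set X -> \bar R}.
Variable m : model mu.

Lemma range_inf_le (Y : Type) (f : Y -> R) y :
  (forall y, 0 <= f y) -> inf (range f) <= f y.
Proof.
by move=> f0; apply: ge_inf; [exists 0 => _ [z _ <-]|exists y].
Qed.

Lemma range_sup_ge (Y : Type) (f : Y -> R) y :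
  has_ubound (range f) -> f y <= sup (range f).
Proof. by move=> fub; apply: ub_le_sup => //; exists y. Qed.

Variable T : nat.
Hypothesis mixing : strong_mixing m T.

Let G_inf_le t x : G_inf m t <= G m t x.
Proof. by apply: range_inf_le => y; exact: potential_ge0. Qed.

Let M_inf_le t x y : M_inf m t <= M m t x y.
Proof.
apply: (@range_inf_le (X * X)%type (fun z => M m t z.1 z.2) (x, y)) => z.
exact: tdensity_ge0.
Qed.

Let le_G_sup t x : (1 <= t <= T)%N -> G m t x <= G_sup m t.
Proof. by move=> /(proj1 mixing)[_ ub]; exact: range_sup_ge. Qed.

Let le_M_sup t x y : (2 <= t <= T)%N -> M m t x y <= M_sup m t.
Proof.
move=> /(proj2 mixing)[_ ub].
exact: (@range_sup_ge (X * X)%type (fun z => M m t z.1 z.2) (x, y)).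
Qed.

Lemma mixing_potential_gt0 t x : (1 <= t <= T)%N -> 0 < G m t x.
Proof. by move=> /(proj1 mixing)[i0 _]; exact: lt_le_trans i0 (G_inf_le t x). Qed.

Let qG t := G_inf m t / G_sup m t.
Let qM t := M_inf m t / M_sup m t.

Let ratioE t : mixing_ratio m t = qG t * qM t.+1 * qG t.+1.
Proof. by rewrite /mixing_ratio /qG /qM !invfM; ring. Qed.

Let qG_bounds t : (1 <= t <= T)%N -> 0 < qG t <= 1.
Proof.
move=> tT; have [i0 _] := proj1 mixing t tT.
have is_ : G_inf m t <= G_sup m t.
  exact: le_trans (G_inf_le t point) (le_G_sup point tT).
have s0 := lt_le_trans i0 is_.
by rewrite divr_gt0//= ler_pdivrMr// mul1r.
Qed.

Let qM_bounds t : (2 <= t <= T)%N -> 0 < qM t <= 1.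
Proof.
move=> tT; have [i0 _] := proj2 mixing t tT.
have is_ : M_inf m t <= M_sup m t.
  exact: le_trans (M_inf_le t point point) (le_M_sup point point tT).
have s0 := lt_le_trans i0 is_.
by rewrite divr_gt0//= ler_pdivrMr// mul1r.
Qed.

Let eps := mixing_constant m T.

Let eps_le t : (1 <= t < T)%N -> eps <= qG t * qM t.+1 * qG t.+1.
Proof.
move=> /andP[t1 tT]; rewrite -ratioE /eps /mixing_constant.
rewrite leqNgt (leq_ltn_trans t1 tT)/=.
by apply: bigmin_seq_le; rewrite mem_index_iota t1.
Qed.

Lemma mixing_constant_ge0 : (1 <= T)%N -> 0 <= eps.
Proof.
move=> T1; rewrite /eps /mixing_constant.
have rr t : (1 <= t < T)%N -> 0 <= mixing_ratio m t.
  move=> /andP[t1 tT]; rewrite ratioE.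
  have /andP[/ltW a _] := @qG_bounds t (introT andP (conj t1 (ltnW tT))).
  have /andP[/ltW b _] := @qM_bounds t.+1 (introT andP (conj t1 tT)).
  have /andP[/ltW c _] := @qG_bounds t.+1 (introT andP (conj isT tT)).
  exact: mulr_ge0 (mulr_ge0 a b) c.
case: leqP => [_|T2].
  by have /andP[/ltW] := @qG_bounds 1%N (introT andP (conj isT T1)).
(* The neutral element is the ratio at time 1, a genuine term since [T] exceeds 1 here. *)
rewrite big_nat; apply: (big_ind (fun x => 0 <= x)) => //; first exact: (rr 1%N).
by move=> x y x0 y0; rewrite le_min x0.
Qed.

(** [eps] is at most [qG t * qM t.+1], the third factor of the ratio being at most 1, and these two
    ratios turn suprema into infima. *)
Lemma mixing_transition t x x' y : (1 <= t < T)%N ->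
  eps * (G m t x * M m t.+1 x y) <= G m t x' * M m t.+1 x' y.
Proof.
move=> tT; have /andP[t1 tT'] := tT.
have t1T : (1 <= t <= T)%N by rewrite t1 ltnW.
have t2T : (2 <= t.+1 <= T)%N by rewrite ltnS t1.
have /andP[a0 a1] := qG_bounds t1T.
have /andP[b0 b1] := qM_bounds t2T.
have /andP[c0 c1] := @qG_bounds t.+1 tT'.
have [gi0 _] := proj1 mixing t t1T; have [mi0 _] := proj2 mixing t.+1 t2T.
have gs0 : 0 < G_sup m t
  by apply: lt_le_trans (le_G_sup point t1T); exact: mixing_potential_gt0.
have ms0 : 0 < M_sup m t.+1.
  by apply: lt_le_trans (le_M_sup point point t2T); exact: lt_le_trans mi0 (M_inf_le _ _ _).
apply: (@le_trans _ _ ((qG t * qM t.+1) * (G_sup m t * M_sup m t.+1))).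
  apply: ler_pM.
  - by apply: mixing_constant_ge0; exact: leq_trans (ltnW tT').
  - by rewrite mulr_ge0 ?potential_ge0 ?tdensity_ge0.
  - apply: le_trans (eps_le tT) _; rewrite ler_piMr//; first by rewrite mulr_ge0// ltW.
  - by apply: ler_pM; rewrite ?potential_ge0 ?tdensity_ge0 ?le_G_sup ?le_M_sup.
have -> : (qG t * qM t.+1) * (G_sup m t * M_sup m t.+1) = G_inf m t * M_inf m t.+1.
  by rewrite /qG /qM; field; rewrite !gt_eqF.
by apply: ler_pM; rewrite ?G_inf_le ?M_inf_le// ltW.
Qed.

(** Each ratio involves two consecutive potentials: for [t < T] the first factor of the ratio at [t]
    is used, and for [t = T > 1] the last factor of the ratio at [T - 1]. The case [T = 1] has its
    own definition. *)
Lemma mixing_constant_le_potential t : (1 <= t <= T)%N -> eps <= qG t.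
Proof.
move=> /andP[t1 tT]; have [T2|T2] := ltnP 1 T; last first.
  have tE : t = 1%N by apply/eqP; rewrite eqn_leq t1 (leq_trans tT).
  by rewrite /eps /mixing_constant T2 tE.
have [tT'|Tt] := ltnP t T.
  apply: le_trans (eps_le (introT andP (conj t1 tT'))) _.
  have /andP[a0 a1] := @qG_bounds t (introT andP (conj t1 tT)).
  have /andP[b0 b1] := @qM_bounds t.+1 (introT andP (conj t1 tT')).
  have /andP[c0 c1] := @qG_bounds t.+1 tT'.
  have bc1 : qM t.+1 * qG t.+1 <= 1 by apply: mulr_ile1 => //; exact: ltW.
  by rewrite -mulrA; exact: ler_piMr (ltW a0) bc1.
have tE : t = T by apply/eqP; rewrite eqn_leq tT.
case: t t1 tT Tt tE => // t _ tT _ tE; have t1 : (1 <= t)%N by rewrite -ltnS tE.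
apply: le_trans (eps_le (introT andP (conj t1 tT))) _.
have /andP[a0 a1] := @qG_bounds t (introT andP (conj t1 (ltnW tT))).
have /andP[b0 b1] := @qM_bounds t.+1 (introT andP (conj t1 tT)).
have /andP[c0 c1] := @qG_bounds t.+1 tT.
have ab1 : qG t * qM t.+1 <= 1 by apply: mulr_ile1 => //; exact: ltW.
exact: ler_piMl (ltW c0) ab1.
Qed.

Lemma mixing_potential t x x' : (1 <= t <= T)%N -> eps * G m t x <= G m t x'.
Proof.
move=> tT; have [gi0 _] := proj1 mixing t tT.
have gs0 : 0 < G_sup m t
  by apply: lt_le_trans (le_G_sup point tT); exact: mixing_potential_gt0.
apply: (@le_trans _ _ (qG t * G_sup m t)); last by rewrite /qG divfK ?gt_eqF.
apply: ler_pM; rewrite ?potential_ge0 ?le_G_sup ?mixing_constant_le_potential//.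
by apply: mixing_constant_ge0; case/andP: tT => t1; exact: leq_trans.
Qed.

End mixing.

(** * Final resampling and the bound on the output *)

Lemma CCPF_uncoupled_le d (X : measurableType d) (R : realType)
    (mu : {sigma_finite_measure set X -> \bar R}) (T : nat) (m : model mu)
    (C : forall t, coupling (M m t))
    (mdiag : measurable [set z : X * X | z.1 = z.2])
    (s s' : T.-tuple X) (N : nat) (eps : R) :
  (1 <= T)%N -> 0 <= eps ->
  (forall t x, (1 <= t <= T)%N -> 0 < G m t x) ->
  (forall t x x', (1 <= t <= T)%N -> eps * G m t x <= G m t x') ->
  (forall t x x' y, (1 <= t < T)%N ->
    eps * (G m t x * M m t.+1 x y) <= G m t x' * M m t.+1 x' y) ->
  (CCPF C mdiag s s' N (~` [set S : T.-tuple X * T.-tuple X | S.1 = S.2]) <=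
    (2 * (2 ^+ T - 1) / (1 + N.-1%:R * eps))%:E)%E.
Proof.
move=> T1 eps0 G0 GG GM; set D := [set S | _].
have mD : measurable (~` D) by apply: measurableC; exact: measurable_diag_tuple.
pose n := N.-1; pose level := (n.+1.-tuple ((X * X) * ('I_n.+1 * 'I_n.+1)))%type.
have mI : measurable_fun setT (EFin \o \1_(~` D) : T.-tuple X * T.-tuple X -> \bar R).
  by apply/measurable_EFinP; exact: measurable_indic.
have I0 S : (0 <= (EFin \o \1_(~` D)) S :> \bar R)%E by rewrite lee_fin.
have -> : CCPF C mdiag s s' N (~` D) =
    giry_int (CCPF C mdiag s s' N) (EFin \o \1_(~` D)).
  by rewrite /giry_int integral_indic// setIT.
have mIo : measurable_fun setT ((EFin \o \1_(~` D) : T.-tuple X * T.-tuple X -> \bar R)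
    \o @output _ X n T).
  exact: (measurableT_comp mI (@measurable_output _ X n T)).
rewrite /CCPF /ccpf_law giry_int_map// giry_int_bind_keep//; last first.
  by move=> p; exact: I0.
have msl b : measurable_fun setT (EFin \o @slip _ X R mu m n b T).
  by apply/measurable_EFinP; exact: measurable_slip.
(* Given the history, the outputs can differ only if the final indices are not one common good
   index; [cres_bad_le] bounds this by the bad weights of both filters. *)
apply: (@le_trans _ _ (giry_int (history C mdiag n s s' T)
    (fun h => (slip m false h)%:E + (slip m true h)%:E))%E).
  apply: le_giry_int.
  - apply: (@measurable_giry_int_param _ _ _ _ R (@final_resample _ X R mu m n T)
      (fun p => (EFin \o \1_(~` D)) (output p))) => //.
    exact: measurable_final_resample.
  - by apply: emeasurable_funD; [exact: (msl false)|exact: (msl true)].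
  - by move=> h; apply: integral_ge0 => ab _; exact: I0.
  - move=> h; rewrite /final_resample /resample giry_int_flaw; last 2 first.
    + exact: measurable_from_indices.
    + by move=> ab; exact: I0.
    have om i : 0 < omega m T (last_level h) i by apply: G0; rewrite T1 leqnn.
    have om' i : 0 < omega' m T (last_level h) i by apply: G0; rewrite T1 leqnn.
    have omW i : good h i -> omega m T (last_level h) i = omega' m T (last_level h) i.
      by move=> gi; rewrite /omega /omega' good_position.
    have := cres_bad_le om om' omW; rewrite omega_pos omega'_pos -!slipE.
    rewrite -EFinD -lee_fin; apply: le_trans; rewrite -sumEFin [leRHS]big_mkcond/=.
    apply: lee_sum => -[a a'] _ /=.
    have mass0 := cres_mass_ge0 (fun i => ltW (om i)) (fun i => ltW (om' i)) (a, a').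
    rewrite omega_pos omega'_pos in mass0.
    case: ifPn => [_|].
      by rewrite -[leRHS]mule1 lee_wpmul2l ?lee_fin.
    rewrite negbK => /andP[/eqP <- gh].
    (* A common good index traces back to equal trajectories; [rev_ord] undoes the reversal to
       chronological order. *)
    have oD : D (output (h, (a, a))).
      apply: eq_from_tnth => k; rewrite /output /= !tnth_mktuple.
      rewrite !(tnth_nth point)/= !nth_rev ?size_tuple//.
      by rewrite -!(tnth_nth point _ (rev_ord k)) lineage_good.
    have -> : \1_(~` D) (output (h, (a, a))) = 0 :> R.
      by rewrite indicE memNset//= => /(_ oD).
    by rewrite mule0.
rewrite /giry_int ge0_integralD//; last 4 first.
- by move=> h _; rewrite lee_fin slip_ge0.
- exact: (msl false).
- by move=> h _; rewrite lee_fin slip_ge0.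
- exact: (msl true).
have sl b := history_slip_total_le C mdiag n s s' eps0 G0 GG GM b
  (introT andP (conj T1 (leqnn T))).
apply: le_trans (leeD (sl false) (sl true)) _.
by rewrite -EFinD lee_fin -mulr2n -[leLHS]mulr_natl mulrA.
Qed.

Theorem theorem9 (R : realType) (d : measure_display) (X : measurableType d)
    (mdiag : measurable [set z : X * X | z.1 = z.2])
    (mu : {sigma_finite_measure set X -> \bar R})
    (T : nat) (T_ge1 : (1 <= T)%N) (m : model mu)
    (c_T : (0 < normalizing_constant m T < +oo)%E)
    (mixing : strong_mixing m T)
    (C : forall t, coupling (M m t))
    (N : nat) (N_ge2 : (2 <= N)%N) (s_ref s_ref' : T.-tuple X) :
  let c_star := (mixing_constant m T)^-1 in
  ((1 - (2 ^+ T * T%:R) / ((2 * c_star)^-1 * (N%:R - 1) + 1))%:E <=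
    CCPF C mdiag s_ref s_ref' N
      [set S : T.-tuple X * T.-tuple X | S.1 = S.2])%E.
Proof.
cbv zeta; set eps := mixing_constant m T; set D := [set S | _].
have eps0 : 0 <= eps by exact: mixing_constant_ge0.
have G0 t x : (1 <= t <= T)%N -> 0 < G m t x by exact: mixing_potential_gt0.
have mD : measurable D by exact: measurable_diag_tuple.
have := @CCPF_uncoupled_le _ X R mu T m C mdiag s_ref s_ref' N eps T_ge1 eps0 G0
  (@mixing_potential _ X R mu m T mixing) (@mixing_transition _ X R mu m T mixing).
rewrite -/D => bad.
(* A lower bound through the complement requires total mass exactly 1, which positivity of the
   potentials ensures. *)
have := CCPF_setT C mdiag s_ref s_ref' N T_ge1 G0.
rewrite -(setvU D) measureU//; [|exact: measurableC|by rewrite setICl].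
move=> total.
have n0 : 0 <= N.-1%:R * eps by rewrite mulr_ge0.
(* The denominator of the theorem has [eps / 2] where the bound obtained has [eps]. *)
have den : 1 + N.-1%:R * eps / 2 <= 1 + N.-1%:R * eps.
  by rewrite lerD2l ler_pdivrMr// ler_peMr// ler1n.
have bnd : 2 * (2 ^+ T - 1) / (1 + N.-1%:R * eps) <=
    2 ^+ T * T%:R / ((2 * eps^-1)^-1 * (N%:R - 1) + 1) :> R.
  have -> : (2 * eps^-1)^-1 * (N%:R - 1) + 1 = 1 + N.-1%:R * eps / 2 :> R.
    rewrite invfM invrK -{1}(prednK (ltnW N_ge2)) -natr1; ring.
  apply: ler_pM.
  - by rewrite mulr_ge0// subr_ge0 exprn_ege1// ler1n.
  - by rewrite invr_ge0 addr_ge0.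
  (* [2 (2^T - 1) <= 2^T T] is an equality at [T = 1]; from [T = 2] on it holds factor by factor, as
     [2 <= T]. *)
  - case: (T) T_ge1 => [//|[|T'] _]; first by rewrite expr1; lra.
    rewrite mulrC; apply: ler_pM; rewrite ?subr_ge0 ?exprn_ege1 ?ler1n//.
      by rewrite gerBl.
    by rewrite ler_nat.
  - by rewrite lef_pV2 ?posrE ?ltr_wpDr// divr_ge0.
rewrite EFinB leeBlDr// addeC -[leLHS]total leeD2r//.
by apply: le_trans bad _; rewrite lee_fin.
Qed.
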